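(* If $G$ is an irreducible map on a surface $S$, then there is at least one irreducible triangulation $T$ of $S$ such that $G$ is obtained from $T$ by removing a set of vertices of $T$ together with all edges incident to these vertices.
   Context: A surface is a compact two-dimensional manifold (without boundary). All graphs are simple. A map on $S$ is a connected simple graph embedded in $S$ such that every face (connected component of the complement of the graph) is homeomorphic to an open disk. A face whose boundary walk traverses edges $v_1v_2,\dots,v_mv_1$ is denoted $v_1\cdots v_m$ (vertices need not be distinct, subscripts mod $m$) and has size $m$; a face of size $3$ is a $3$-face and a face of size $m\ge 4$ is large. A large face $v_1\cdots v_m$ is irreducible if $v_i$ and $v_{i+2}$ are adjacent for every $i$. A map is face irreducible if every face is an irreducible face or a $3$-face. If $v_1v_2,v_2v_3,v_3v_1$ are edges, their union is the $3$-cycle $v_1v_2v_3$. An edge is contractible if it lies on exactly two $3$-cycles and both are (boundaries of) $3$-faces. An irreducible map is a face irreducible map with no contractible edge. A triangulation of $S$ is a map on $S$ in which the boundary of every face is a $3$-cycle, excluding the map consisting of a single $3$-cycle on the sphere. An irreducible triangulation is a triangulation with no contractible edge.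
   Formalization: On the sphere the tetrahedron is counted as an irreducible triangulation although its edges are contractible by the literal definition; otherwise the single 3-cycle on the sphere, an irreducible map, would be a counterexample. Other surfaces are unaffected. *)

(* Defs.v *)
(* Maps on closed surfaces are encoded by their flags, i.e. by the
   triangles of the barycentric subdivision: a flag is a mutually incident
   triple (vertex, edge side, face corner).  The involutions [fl0], [fl1],
   [fl2] exchange a flag with the one that differs from it only in the vertex,
   the edge, the face respectively.  Non-orientable surfaces are covered.      *)
From mathcomp Require Import all_boot all_order all_algebra.

Set Implicit Arguments.
Unset Strict Implicit.
Unset Printing Implicit Defensive.

Import GRing.Theory.

(* Absence of fixed points of [fl0], [fl1], [fl2] means that the surface has no
   boundary; the two laws on [fl0] and [fl2] say that every edge has exactly
   four flags (two ends, two sides).                                          *)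
Record flag_system := FlagSystem {
  flag :> finType;
  fl0 : flag -> flag;
  fl1 : flag -> flag;
  fl2 : flag -> flag;
  fl0K : involutive fl0;
  fl1K : involutive fl1;
  fl2K : involutive fl2;
  fl0_neq : forall x, fl0 x != x;
  fl1_neq : forall x, fl1 x != x;
  fl2_neq : forall x, fl2 x != x;
  fl02C : forall x, fl0 (fl2 x) = fl2 (fl0 x);
  fl02_neq : forall x, fl0 (fl2 x) != x
}.

Arguments fl0 {f} x : rename.
Arguments fl1 {f} x : rename.
Arguments fl2 {f} x : rename.

Definition orbit2 (T : finType) (f g : T -> T) (x : T) : {set T} :=
  [set y | connect [rel u v | (v == f u) || (v == g u)] x y].

Section Maps.

Variable M : flag_system.
Implicit Types (x y : M) (a b c : {set M}) (C : {set {set M}}).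

Definition vtx x : {set M} := orbit2 fl1 fl2 x.
Definition edg x : {set M} := orbit2 fl0 fl2 x.
Definition fac x : {set M} := orbit2 fl0 fl1 x.

Definition vertices : {set {set M}} := [set vtx x | x : M].
Definition edges : {set {set M}} := [set edg x | x : M].
Definition faces : {set {set M}} := [set fac x | x : M].

(* The edge [edg x] joins [vtx x] and [vtx (fl0 x)]. *)
Definition adj a b : bool := [exists x, (vtx x == a) && (vtx (fl0 x) == b)].

(* The edgeless map (one vertex on the sphere) has no flag and is left out; its
   only face has size 0, so it is neither face irreducible nor a triangulation. *)
Definition is_map : Prop :=
  [/\ exists x : M, True,
      forall x y,
        connect [rel u v : M | [|| v == fl0 u, v == fl1 u | v == fl2 u]] x y,
      forall x, vtx x != vtx (fl0 x)
    & forall x y,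
        vtx x = vtx y -> vtx (fl0 x) = vtx (fl0 y) -> edg x = edg y].

Definition euler_char : int :=
  (#|vertices|%:Z - #|edges|%:Z + #|faces|%:Z)%R.

Definition orientable : Prop :=
  exists s : M -> bool,
    forall x, [/\ s (fl0 x) = ~~ s x, s (fl1 x) = ~~ s x & s (fl2 x) = ~~ s x].

(* One step along the boundary walk of the face of [x]: the walk visits the
   vertices v_i = vtx (iter i face_step x) and closes after
   [order face_step x] steps. *)
Definition face_step x : M := fl1 (fl0 x).
Definition face_vertex x (i : nat) : {set M} := vtx (iter i face_step x).
Definition face_size x : nat := order face_step x.

Definition irreducible_face x : Prop :=
  4 <= face_size x /\ forall i, adj (face_vertex x i) (face_vertex x i.+2).

Definition face_irreducible : Prop :=
  forall x, irreducible_face x \/ face_size x = 3.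

(* As the graph is simple, a 3-cycle is determined by its set of vertices. *)
Definition three_cycle C : bool :=
  [exists a, exists b, exists c,
    [&& adj a b, adj b c, adj c a & C == [set a; b; c]]].

Definition bounds_three_face C : bool :=
  [exists x, (face_size x == 3) &&
    (C == [set face_vertex x 0; face_vertex x 1; face_vertex x 2])].

Definition three_cycles_through x : {set {set {set M}}} :=
  [set C | [&& three_cycle C, vtx x \in C & vtx (fl0 x) \in C]].

Definition contractible x : Prop :=
  #|three_cycles_through x| = 2 /\
  forall C, C \in three_cycles_through x -> bounds_three_face C.

Definition irreducible_map : Prop :=
  [/\ is_map, face_irreducible & forall x, ~ contractible x].

Definition sphere_three_cycle : Prop :=
  three_cycle vertices /\ euler_char = 2%R.

Definition triangulation : Prop :=
  [/\ is_map, forall x, face_size x = 3 & ~ sphere_three_cycle].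

Definition tetrahedron : Prop :=
  [/\ triangulation, #|vertices| = 4 & euler_char = 2%R].

(* Contracting an edge of the tetrahedron yields the 3-cycle on the sphere, which
   is not a triangulation; the tetrahedron counts, as usual, as the irreducible
   triangulation of the sphere.  On every other surface the first alternative
   cannot occur. *)
Definition irreducible_triangulation : Prop :=
  triangulation /\ (tetrahedron \/ forall x, ~ contractible x).

End Maps.

(* By the classification of closed connected surfaces, the surfaces that carry M
   and N are homeomorphic. *)
Definition same_surface (M N : flag_system) : Prop :=
  euler_char M = euler_char N /\ (orientable M <-> orientable N).

Definition kept (T : flag_system) (W : {set {set T}}) (y : T) : bool :=
  (vtx y \notin W) && (vtx (fl0 y) \notin W).

(* G is, as an embedded graph, T - W.  [phi] identifies the flags of G with the
   flags of T on surviving edges.  Around a vertex, the corner next to [phi x] in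
   T - W is reached from the one in T by rotating across deleted edges, i.e. by
   iterating fl1 \o fl2 until a surviving edge is met.  The last clause forbids
   surviving vertices that have lost all their edges.  When moreover
   [same_surface G T], the faces of T - W in the surface of T are open disks. *)
Definition obtained_by_removing
    (T : flag_system) (W : {set {set T}}) (G : flag_system) : Prop :=
  exists phi : G -> T,
    [/\ injective phi,
        forall y, kept W y <-> exists x, phi x = y,
        forall x, phi (fl0 x) = fl0 (phi x) /\ phi (fl2 x) = fl2 (phi x),
        forall x, exists n,
          phi (fl1 x) = iter n (fl1 \o fl2) (fl1 (phi x)) /\
          forall k, k < n -> ~~ kept W (iter k (fl1 \o fl2) (fl1 (phi x)))
      & forall a, a \in vertices T -> a \notin W -> exists x, vtx (phi x) = a].

(* Main.v *)
(* New vertices are put into the large faces of G, one at a time, until only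
   triangles are left.  A new vertex w placed in a face F is joined to exactly
   one occurrence of each vertex on the boundary walk of F, which keeps the graph
   simple.  Hence both ends of every edge of F become adjacent to w.  Call the
   potential of an edge its number of common neighbours plus its number of
   non-triangular sides; it stays at least 3, because an edge of F gains the
   common neighbour w and loses at most one non-triangular side.  In the end all
   faces are triangles, so every edge has three common neighbours and lies on
   three 3-cycles.

   Filling F creates triangles and "hatted" faces w v_i ... v_j, where w is
   adjacent to every v_k and v_k to v_(k+2).  A hatted face is filled in the same
   way, using the corners at w, v_i and v_j.  In an irreducible face of G the
   occurrences have to be chosen with care only where the walk reads b a c b a.

   In G itself the potential is at least 3 unless G is the 3-cycle on the sphere,
   for which filling one of the two triangles gives the tetrahedron. *)
Require Import Defs.
From mathcomp Require Import all_boot all_order all_algebra.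
From mathcomp Require Import zify.

Set Implicit Arguments.
Unset Strict Implicit.
Unset Printing Implicit Defensive.

(** * Orbits of two involutions, and counting by invariants *)

Section Orbit2.

Variables (T : finType) (f g : T -> T).
Hypotheses (fK : involutive f) (gK : involutive g).

Let e := [rel u v | (v == f u) || (v == g u)].

Lemma orbit2_connect_sym : connect_sym e.
Proof.
apply: sym_connect_sym => u v /=.
by apply/orP/orP => -[] /eqP ->; rewrite ?fK ?gK eqxx; auto.
Qed.

Lemma orbit2_refl x : x \in orbit2 f g x.
Proof. by rewrite inE connect0. Qed.

Lemma orbit2P x y : reflect (orbit2 f g x = orbit2 f g y) (y \in orbit2 f g x).
Proof.
apply: (iffP idP) => [|->]; last exact: orbit2_refl.
rewrite inE => xy; apply/setP => z; rewrite !inE.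
exact: (same_connect orbit2_connect_sym).
Qed.

Lemma orbit2_left x : orbit2 f g (f x) = orbit2 f g x.
Proof. by apply/esym/orbit2P; rewrite inE connect1 //= eqxx. Qed.

Lemma orbit2_right x : orbit2 f g (g x) = orbit2 f g x.
Proof. by apply/esym/orbit2P; rewrite inE connect1 //= eqxx orbT. Qed.

Lemma orbit2_ind (P : T -> Prop) x :
  P x -> (forall y, y \in orbit2 f g x -> P y -> P (f y)) ->
  (forall y, y \in orbit2 f g x -> P y -> P (g y)) ->
  forall y, y \in orbit2 f g x -> P y.
Proof.
move=> Px Pf Pg y; rewrite inE => /connectP [p + ->].
elim/last_ind: p => [//|p z IH]; rewrite rcons_path last_rcons => /andP [xp].
have xl : last x p \in orbit2 f g x by rewrite inE; apply/connectP; exists p.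
by case/orP => /eqP ->; [apply: Pf|apply: Pg] => //; apply: IH.
Qed.

Lemma orbit2_inv (S : Type) (h : T -> S) x y :
  (forall z, h (f z) = h z) -> (forall z, h (g z) = h z) ->
  y \in orbit2 f g x -> h y = h x.
Proof.
move=> hf hg; apply: (@orbit2_ind (fun y => h y = h x)) => // z _.
  by rewrite hf.
by rewrite hg.
Qed.

End Orbit2.

(** Both images are in bijection with the image of the paired map. This is how orbits are counted by
    means of a complete invariant. *)
Lemma eq_card_imset (T : finType) (S1 S2 : finType) (h1 : T -> S1)
    (h2 : T -> S2) (A : {pred T}) :
  {in A &, forall x y, h1 x = h1 y <-> h2 x = h2 y} ->
  #|h1 @: A| = #|h2 @: A|.
Proof.
move=> h12.
have -> : #|h1 @: A| = #|[set (h1 x, h2 x) | x in A]|.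
  have -> : h1 @: A = fst @: [set (h1 x, h2 x) | x in A].
    by rewrite -imset_comp.
  rewrite card_in_imset // => _ _ /imsetP [x Ax ->] /imsetP [y Ay ->] /= e.
  by rewrite e; congr pair; apply/h12.
have -> : h2 @: A = snd @: [set (h1 x, h2 x) | x in A].
  by rewrite -imset_comp.
rewrite [RHS]card_in_imset // => _ _ /imsetP [x Ax ->] /imsetP [y Ay ->] /= e.
by rewrite e; congr pair; apply/h12.
Qed.

Lemma pair_eq (T : finType) (f : T -> T) x y :
  [set x; f x] = [set y; f y] -> y = x \/ y = f x.
Proof.
move=> /setP /(_ y); rewrite !inE eqxx /=.
by case/orP => /eqP; [left|right].
Qed.

Lemma card_pairs_involution (T : finType) (f : T -> T) (K : {set T}) :
  {in K, forall x, f x \in K} -> {in K, involutive f} ->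
  {in K, forall x, f x != x} -> #|K| = #|[set [set x; f x] | x in K]| * 2.
Proof.
move=> fK fKK fN; rewrite -sum1_card.
rewrite (partition_big_imset (fun x => [set x; f x])) /=.
rewrite (eq_bigr (fun _ => 2)) ?sum_nat_const // => _ /imsetP [x Kx ->].
rewrite sum1dep_card -[RHS](_ : #|[set x; f x]| = 2); last first.
  by rewrite cards2 eq_sym fN.
apply: eq_card => y; rewrite !inE.
apply/andP/orP => [[Ky /eqP e]|].
  by case: (@pair_eq _ f x y (esym e)) => ->; rewrite eqxx; auto.
case=> /eqP -> //; split; rewrite ?fK ?fKK //.
by apply/eqP; rewrite setUC.
Qed.

(** * Flags, triangles and the potential of an edge *)

Section MapFacts.

Variable M : flag_system.
Implicit Types (x y z : M) (a b c : {set M}).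

Lemma fac_refl x : x \in fac x. Proof. exact: orbit2_refl. Qed.
Lemma vtxP x y : reflect (vtx x = vtx y) (y \in vtx x).
Proof. exact: (orbit2P (@fl1K M) (@fl2K M)). Qed.
Lemma edgP x y : reflect (edg x = edg y) (y \in edg x).
Proof. exact: (orbit2P (@fl0K M) (@fl2K M)). Qed.
Lemma facP x y : reflect (fac x = fac y) (y \in fac x).
Proof. exact: (orbit2P (@fl0K M) (@fl1K M)). Qed.
Lemma vtx1 x : vtx (fl1 x) = vtx x.
Proof. exact: (orbit2_left (@fl1K M) (@fl2K M)). Qed.
Lemma vtx2 x : vtx (fl2 x) = vtx x.
Proof. exact: (orbit2_right (@fl1K M) (@fl2K M)). Qed.
Lemma edg0 x : edg (fl0 x) = edg x.
Proof. exact: (orbit2_left (@fl0K M) (@fl2K M)). Qed.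
Lemma edg2 x : edg (fl2 x) = edg x.
Proof. exact: (orbit2_right (@fl0K M) (@fl2K M)). Qed.
Lemma fac0 x : fac (fl0 x) = fac x.
Proof. exact: (orbit2_left (@fl0K M) (@fl1K M)). Qed.
Lemma fac1 x : fac (fl1 x) = fac x.
Proof. exact: (orbit2_right (@fl0K M) (@fl1K M)). Qed.

Lemma in_fac0 x y : (fl0 y \in fac x) = (y \in fac x).
Proof. by apply/facP/facP; rewrite fac0. Qed.
Lemma in_fac1 x y : (fl1 y \in fac x) = (y \in fac x).
Proof. by apply/facP/facP; rewrite fac1. Qed.

Lemma edg_inP x y :
  y \in edg x -> [\/ y = x, y = fl0 x, y = fl2 x | y = fl0 (fl2 x)].
Proof.
move: y; apply: orbit2_ind; first by constructor 1.
- move=> y _ [] ->; rewrite ?fl0K; by [constructor 2|constructor 1|constructor 4|constructor 3].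
- move=> y _ [] ->; rewrite ?fl02C ?fl2K -?fl02C;
    by [constructor 3|constructor 4|constructor 1|constructor 2].
Qed.

Lemma flag_connect_sym :
  connect_sym [rel u v : M | [|| v == fl0 u, v == fl1 u | v == fl2 u]].
Proof.
apply: sym_connect_sym => u v /=.
by apply/idP/idP => /or3P [] /eqP ->; rewrite ?fl0K ?fl1K ?fl2K eqxx ?orbT.
Qed.

Lemma adjP a b : reflect (exists2 x, vtx x = a & vtx (fl0 x) = b) (adj a b).
Proof.
apply: (iffP existsP) => [[x /andP [/eqP <- /eqP <-]]|[x <- <-]]; exists x => //.
by rewrite !eqxx.
Qed.

Lemma adj_sym a b : adj a b = adj b a.
Proof. by apply/adjP/adjP => -[x <- <-]; exists (fl0 x); rewrite ?fl0K. Qed.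

Lemma adj_fl0 x : adj (vtx x) (vtx (fl0 x)).
Proof. by apply/adjP; exists x. Qed.

Definition tri x := iter 3 (@face_step M) x == x.

Lemma face_step_inj : injective (@face_step M).
Proof. by move=> x y /(can_inj (@fl1K M)) /(can_inj (@fl0K M)). Qed.

Lemma triE x : tri x = (fl1 (fl0 (fl1 x)) == fl0 (fl1 (fl0 x))).
Proof.
rewrite /tri /= /face_step; apply/eqP/eqP => e.
  by rewrite -{1}e !(fl0K, fl1K).
by rewrite -e !(fl0K, fl1K).
Qed.

Lemma tri_fl1 x : tri (fl1 x) = tri x.
Proof. by rewrite !triE fl1K; apply/eqP/eqP => e; rewrite e fl0K. Qed.

Lemma tri_fl0 x : tri (fl0 x) = tri x.
Proof. by rewrite !triE fl0K; apply/eqP/eqP => e; rewrite -e fl1K. Qed.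

Lemma tri_fac x y : y \in fac x -> tri y = tri x.
Proof. by apply: orbit2_inv; [apply: tri_fl0|apply: tri_fl1]. Qed.

(** If the walk closes after three steps, its order divides 3, and order 1 would give a loop. *)
Lemma face_size3 x : is_map M -> face_size x = 3 <-> tri x.
Proof.
case=> _ _ noloop _; rewrite /face_size; split=> [e|/eqP /= tx].
  by rewrite /tri -{2}(iter_order face_step_inj x) e.
have n1 y : y != face_step y.
  by apply: contraNneq (noloop y) => {1}->; rewrite /face_step vtx1.
rewrite (@order_cycle _ _ (traject (@face_step M) x 3)) ?inE ?eqxx //=.
  by rewrite tx !eqxx.
rewrite !inE !negb_or !n1 /= andbT.
by apply: contraNneq (n1 x) => e; rewrite {2}e tx.
Qed.

Definition common x : {set {set M}} :=
  [set c | adj (vtx x) c && adj c (vtx (fl0 x))].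

Definition pot x := #|common x| + ~~ tri x + ~~ tri (fl2 x).

Lemma tri_fl02 x : tri (fl2 (fl0 x)) = tri (fl2 x).
Proof. by rewrite -fl02C tri_fl0. Qed.

Lemma pot_fl0 x : pot (fl0 x) = pot x.
Proof.
rewrite /pot tri_fl0 tri_fl02; congr (_ + _ + _).
by apply: eq_card => c; rewrite !inE fl0K andbC adj_sym [adj c _]adj_sym.
Qed.

(* [z] is at the hat, and [P] contains the corners of the face of [z] that are
   neither at the hat nor next to it. *)
Definition hat (P : {set M}) z : Prop :=
  [/\ vtx (fl0 z) <> vtx (fl0 (fl1 z)),
      forall y, y \in fac z -> y \notin [:: z; fl1 z] -> adj (vtx z) (vtx y)
    & forall y, y \in fac z ->
        y \notin [:: z; fl1 z; fl0 z; fl1 (fl0 z); fl0 (fl1 z); fl1 (fl0 (fl1 z))] ->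
        y \in P].

(** The only faces met during the filling: triangles, large faces of the original map not yet
    touched, and hatted faces. *)
Definition face_kind (P : {set M}) x : Prop :=
  [\/ tri x, {subset fac x <= P} | exists2 z, z \in fac x & hat P z].

End MapFacts.

Lemma card_ge3 (T : finType) (A : {set T}) a b c :
  a \in A -> b \in A -> c \in A -> a != b -> a != c -> b != c -> 3 <= #|A|.
Proof.
move=> Aa Ab Ac ab ac bc.
have <- : #|[set a; b; c]| = 3.
  by rewrite setUC cardsU1 cards2 !inE ab !(eq_sym c) negb_or ac bc.
by apply: subset_leq_card; apply/subsetP => d; rewrite !inE => /orP[/orP[]|] /eqP ->.
Qed.

(** The content of [obtained_by_removing] without the removed set, so that it can be carried from
    one star to the next. The image takes the place of [kept], and the last clause makes it an
    induced subgraph. *)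
Definition submap (G M : flag_system) (phi : G -> M) : Prop :=
  [/\ injective phi,
      forall x, phi (fl0 x) = fl0 (phi x) /\ phi (fl2 x) = fl2 (phi x),
      forall x, exists n,
        phi (fl1 x) = iter n (fl1 \o fl2) (fl1 (phi x)) /\
        forall k, k < n -> forall y, phi y <> iter k (fl1 \o fl2) (fl1 (phi x))
    & forall y, (exists x, vtx (phi x) = vtx y) ->
        (exists x, vtx (phi x) = vtx (fl0 y)) -> exists x, phi x = y].

(** The inverse of [face_step]. *)
Definition rstep (M : flag_system) (x : M) : M := fl0 (fl1 x).

(** * Adding a new vertex inside a face *)

Section Star.

Variables (M : flag_system) (z0 : M) (K : {set M}).
Hypotheses (K0 : z0 \in K) (KF : {subset K <= fac z0}).
Hypothesis (K1 : forall z, (fl1 z \in K) = (z \in K)).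

Implicit Types (x y z : M).

Let F := fac z0.

(* [hit x] is the first flag of [K] among x, rstep x, rstep (rstep x), ...; for
   [x] in [K], [x] and [nxt x] are the two ends of a boundary arc of the face
   between consecutive corners of [K]. *)
Fixpoint walk n x : M :=
  if x \in K then x else if n is n'.+1 then walk n' (rstep x) else x.

Definition hit x := walk #|M| x.
Definition nxt x := hit (fl0 x).

Lemma walkS n x : walk n x \in K -> walk n.+1 x = walk n x.
Proof.
elim: n x => [|n IH] x; first by rewrite /=; case: ifP => //= ->.
by rewrite [walk n.+2 x]/= [walk n.+1 x]/=; case: ifP => //= _ /IH.
Qed.

Lemma walk_reach n N x :
  n <= N -> iter n (@rstep M) x \in K -> walk N x \in K.
Proof.
elim: N n x => [|N IH] [|n] x //=; first by move=> _ Kx; rewrite Kx.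
- by move=> _ Kx; rewrite Kx.
- by case: ifP => //= _ nN; rewrite -iterS iterSr; apply: IH.
Qed.

(** The [rstep] orbit of [x] contains [z0] or [fl1 z0], and both are in [K]. An orbit has at most
    [#|M|] elements, so the bound in [hit] is never exhausted first. *)
Lemma hit_in x : x \in F -> hit x \in K.
Proof.
pose g := @rstep M.
have g_inj : injective g by move=> u v /(can_inj (@fl0K M)) /(can_inj (@fl1K M)).
move=> Fx; have : fconnect g x z0 \/ fconnect g x (fl1 z0).
  have: z0 \in fac x by apply/facP; rewrite -(facP _ _ Fx).
  apply: (@orbit2_ind _ fl0 fl1 (fun y => fconnect g x y \/ fconnect g x (fl1 y))).
  - by left; apply: connect0.
  - move=> y _ [] xy; [right|left].
      apply: connect_trans xy _; rewrite fconnect_sym //; apply: connect1.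
      by rewrite /= /g /rstep fl1K fl0K.
    apply: connect_trans xy _; apply: connect1.
    by rewrite /= /g /rstep fl1K.
  - by move=> y _; rewrite fl1K => -[]; auto.
have reach y : y \in K -> fconnect g x y -> hit x \in K.
  move=> Ky xy; apply: (@walk_reach (findex g x y)).
    by apply: leq_trans (max_card (fconnect g x)); apply: ltnW; apply: findex_max.
  by rewrite iter_findex.
by case; apply: reach; rewrite ?K1.
Qed.

Lemma hit_id x : x \in K -> hit x = x.
Proof. by move=> Kx; rewrite /hit; case: #|M| => [|n] /=; rewrite Kx. Qed.

Lemma hit_step x : x \in F -> x \notin K -> hit x = hit (fl0 (fl1 x)).
Proof.
move=> Fx nKx; have := hit_in Fx; rewrite /hit.
have [n ->] : exists n, #|M| = n.+1.
  by exists #|M|.-1; rewrite prednK //; apply/card_gt0P; exists z0.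
rewrite [walk _ x]/= (negbTE nKx) => /walkS ->.
by [].
Qed.

Lemma hit_ind (P : M -> Prop) :
  (forall x, x \in K -> P x) ->
  (forall x, x \in F -> x \notin K -> P (fl0 (fl1 x)) -> P x) ->
  forall x, x \in F -> P x.
Proof.
move=> PK Pstep x Fx.
have: walk #|M| x \in K by apply: hit_in.
elim: #|M| x Fx => [|n IH] x Fx /=; case: ifP => Kx //=; rewrite ?Kx //.
- by move=> _; apply: PK.
- by move=> _; apply: PK.
- by move/IH => H; apply: Pstep; rewrite ?Kx //; apply: H; rewrite in_fac0 in_fac1.
Qed.

Lemma hit_fl1 x : x \in F -> x \notin K -> hit (fl1 x) = hit (fl0 x).
Proof. by move=> Fx nKx; rewrite hit_step ?in_fac1 ?K1 // fl1K. Qed.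

(** All flags passed on the way from [x] to one end of its arc see the same other end. *)
Lemma hit_fl0_hit x : x \in F -> nxt (hit x) = nxt x.
Proof.
move: x; apply: hit_ind => x; first by move/hit_id->.
by move=> Fx nKx; rewrite -hit_step // => ->; rewrite /nxt fl0K hit_fl1.
Qed.

Lemma nxt_in x : x \in F -> nxt x \in K.
Proof. by move=> Fx; apply: hit_in; rewrite in_fac0. Qed.

Lemma nxtK z : z \in K -> nxt (nxt z) = z.
Proof.
by move=> Kz; rewrite hit_fl0_hit ?in_fac0 ?KF // /nxt fl0K hit_id.
Qed.

(* A word of odd length in fl0 and fl1 is a conjugate of fl0 or fl1. *)
Lemma face_word_neq n x : iter n (@rstep M) (fl0 x) <> x :> M.
Proof.
elim/ltn_ind: n x => -[|[|n]] IH x; first by apply/eqP; apply: fl0_neq.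
  move=> /= e; have /eqP[] := fl1_neq (fl0 x).
  by rewrite -[x in RHS]e /rstep fl0K.
move=> e; apply: (IH n _ (fl1 (fl0 x))) => //.
apply: (can_inj (@fl1K M)); apply: (can_inj (@fl0K M)); rewrite fl1K fl0K.
by rewrite -[RHS]e [RHS]iterSr.
Qed.

Lemma hit_iter x : exists n, hit x = iter n (@rstep M) x.
Proof.
rewrite /hit; elim: #|M| x => [|n IH] x /=; first by exists 0; case: ifP.
case: ifP => _; first by exists 0.
by have [k ->] := IH (rstep x); exists k.+1; rewrite iterSr.
Qed.

Lemma nxt_neq z : z \in K -> nxt z != z.
Proof.
move=> Kz; apply/eqP; rewrite /nxt; have [n ->] := hit_iter (fl0 z).
exact: face_word_neq.
Qed.

Definition corner := {z : M | z \in K}.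
(* The new vertex is joined to the corners {z, fl1 z} with [z] in [K].  Each such
   [z] yields two new flags: [(z, false)] at the old end of the new edge, next to
   [z], and [(z, true)] at its new end. *)
Definition star_flag : finType := (M + corner * bool)%type.

Definition star0 (u : star_flag) : star_flag :=
  match u with inl x => inl (fl0 x) | inr (k, b) => inr (k, ~~ b) end.
Definition star2 (u : star_flag) : star_flag :=
  match u with
  | inl x => inl (fl2 x)
  | inr (k, b) => inr (insubd k (fl1 (val k)), b)
  end.
Definition star1 (u : star_flag) : star_flag :=
  match u with
  | inl x => if insub x is Some k then inr (k, false) else inl (fl1 x)
  | inr (k, false) => inl (val k)
  | inr (k, true) => inr (insubd k (nxt (val k)), true)
  end.

Lemma val_fl1 (k : corner) : val (insubd k (fl1 (val k))) = fl1 (val k).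
Proof. by rewrite insubdK // unfold_in K1; apply: valP. Qed.

Lemma val_nxt (k : corner) : val (insubd k (nxt (val k))) = nxt (val k).
Proof. by rewrite insubdK // unfold_in nxt_in // KF //; apply: valP. Qed.

Lemma star1_out x : x \notin K -> star1 (inl x) = inl (fl1 x).
Proof. by move=> nKx /=; rewrite insubF //; apply: negbTE. Qed.

Lemma star1_in (k : corner) : star1 (inl (val k)) = inr (k, false).
Proof. by rewrite /= valK. Qed.

Lemma star0K : involutive star0.
Proof. by case=> [x|[k b]] /=; rewrite ?fl0K ?negbK. Qed.

Lemma star2K : involutive star2.
Proof.
case=> [x|[k b]] /=; first by rewrite fl2K.
by congr (inr (_, _)); apply: val_inj; rewrite /= val_fl1 val_fl1 fl1K.
Qed.

Lemma star1K : involutive star1.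
Proof.
case=> [x|[k [|]]].
- have [Kx|nKx] := boolP (x \in K).
    by rewrite -[x]/(val (Sub x Kx : corner)) star1_in.
  by rewrite !star1_out ?K1 // fl1K.
- rewrite /=; congr (inr (_, _)); apply: val_inj.
  by rewrite /= val_nxt val_nxt nxtK //; apply: valP.
- exact: star1_in.
Qed.

Lemma star0_neq u : star0 u != u.
Proof.
case: u => [x|[k b]] /=; first by rewrite (inj_eq inl_inj) fl0_neq.
by apply/eqP => -[]; case: b.
Qed.

Lemma star2_neq u : star2 u != u.
Proof.
case: u => [x|[k b]] /=; first by rewrite (inj_eq inl_inj) fl2_neq.
apply/eqP => -[/(congr1 val)]; rewrite val_fl1 => e.
by have := fl1_neq (val k); rewrite e eqxx.
Qed.

Lemma star1_neq u : star1 u != u.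
Proof.
case: u => [x|[k [|]]] /=; first by case: insubP => // _; rewrite (inj_eq inl_inj) fl1_neq.
  apply/eqP => -[/(congr1 val)]; rewrite val_nxt => e.
  by have := nxt_neq (valP k); rewrite e eqxx.
by [].
Qed.

Lemma star02C u : star0 (star2 u) = star2 (star0 u).
Proof. by case: u => [x|[k b]] //=; rewrite fl02C. Qed.

Lemma star02_neq u : star0 (star2 u) != u.
Proof.
case: u => [x|[k b]] /=; first by rewrite (inj_eq inl_inj) fl02_neq.
by apply/eqP => -[_]; case: b.
Qed.

Definition star : flag_system :=
  FlagSystem star0K star1K star2K star0_neq star1_neq star2_neq star02C star02_neq.

Implicit Types (u v : star) (k : corner).

Definition old x : star := inl x.
Definition spoke k : star := inr (k, false).
Definition hub k : star := inr (k, true).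

Lemma star_flagP u :
  [\/ exists x, u = old x, exists k, u = spoke k | exists k, u = hub k].
Proof.
by case: u => [x|[k [|]]]; [constructor 1|constructor 3|constructor 2];
  [exists x|exists k|exists k].
Qed.

Lemma old_inj : injective old. Proof. by move=> x y []. Qed.

Lemma fl0_old x : fl0 (old x) = old (fl0 x). Proof. by []. Qed.
Lemma fl2_old x : fl2 (old x) = old (fl2 x). Proof. by []. Qed.
Lemma fl1_old x : x \notin K -> fl1 (old x) = old (fl1 x).
Proof. exact: star1_out. Qed.
Lemma fl1_old_in k : fl1 (old (val k)) = spoke k. Proof. exact: star1_in. Qed.
Lemma fl1_spoke k : fl1 (spoke k) = old (val k). Proof. by []. Qed.
Lemma fl0_spoke k : fl0 (spoke k) = hub k. Proof. by []. Qed.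
Lemma fl0_hub k : fl0 (hub k) = spoke k. Proof. by []. Qed.

Definition corner_fl1 k : corner := insubd k (fl1 (val k)).
Definition corner_nxt k : corner := insubd k (nxt (val k)).

Lemma fl2_spoke k : fl2 (spoke k) = spoke (corner_fl1 k). Proof. by []. Qed.
Lemma fl2_hub k : fl2 (hub k) = hub (corner_fl1 k). Proof. by []. Qed.
Lemma fl1_hub k : fl1 (hub k) = hub (corner_nxt k). Proof. by []. Qed.

(** * Vertices, edges and faces of the star, its Euler characteristic and orientability *)

Definition star_vertex u : option {set M} :=
  match u with
  | inl x => Some (vtx x)
  | inr (k, b) => if b then None else Some (vtx (val k))
  end.

Lemma star_vertex1 u : star_vertex (fl1 u) = star_vertex u.
Proof.
case: (star_flagP u) => -[x ->] //.
have [Kx|nKx] := boolP (x \in K).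
  by rewrite -[x]/(val (Sub x Kx : corner)) fl1_old_in.
by rewrite fl1_old //= vtx1.
Qed.

Lemma star_vertex2 u : star_vertex (fl2 u) = star_vertex u.
Proof.
case: (star_flagP u) => -[x ->] //; first by rewrite fl2_old /= vtx2.
by rewrite fl2_spoke /= val_fl1 vtx1.
Qed.

(** A corner in [K] is cut in two by its spoke, but [fl1], [fl2], [fl1] leads across the spoke. *)
Lemma vtx_old_fl1 x : vtx (old (fl1 x)) = vtx (old x).
Proof.
have [Kx|nKx] := boolP (x \in K); last by rewrite -fl1_old // vtx1.
pose k : corner := Sub x Kx.
have -> : fl1 x = val (corner_fl1 k) by rewrite val_fl1.
by rewrite -[x in RHS]/(val k) -!fl1_spoke -fl2_spoke !vtx1 vtx2.
Qed.

Lemma corner_hitP x : x \in F -> exists k, val k = hit x.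
Proof. by move=> Fx; exists (Sub (hit x) (hit_in Fx)). Qed.

(** Walk around [F]: passing along an arc corresponds to [fl1] at the hub, turning at a corner of
    [K] to [fl2] at the hub. So the hub flags form a single vertex. *)
Lemma vtx_hub k k' : vtx (hub k) = vtx (hub k').
Proof.
suff H x : x \in F -> forall k1 k2, val k1 = hit z0 -> val k2 = hit x ->
    vtx (hub k1) = vtx (hub k2).
  have [k0 k0E] := corner_hitP (fac_refl z0).
  have E k1 : val k1 = hit (val k1) by rewrite hit_id //; apply: valP.
  have FE k1 : val k1 \in F by apply/KF/valP.
  by rewrite -(H _ (FE k) _ _ k0E (E k)) -(H _ (FE k') _ _ k0E (E k')).
have step y k1 k2 : y \in F -> val k1 = hit y -> val k2 = hit (fl0 y) ->
    vtx (hub k1) = vtx (hub k2).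
  move=> Fy e1 e2; rewrite -[in LHS]vtx1 fl1_hub; congr (vtx (hub _)).
  by apply: val_inj; rewrite /= val_nxt e1 e2 hit_fl0_hit.
apply: (@orbit2_ind _ fl0 fl1 (fun x => forall k1 k2, val k1 = hit z0 ->
    val k2 = hit x -> vtx (hub k1) = vtx (hub k2))).
- by move=> k1 k2 <- /val_inj ->.
- move=> y Fy IH k1 k2 e1 e2; have [k3 e3] := corner_hitP Fy.
  by rewrite (IH k1 k3) // (step y k3 k2).
- move=> y Fy IH k1 k2 e1 e2; have [k3 e3] := corner_hitP Fy.
  rewrite (IH k1 k3) //; have [Ky|nKy] := boolP (y \in K).
    rewrite -[in LHS]vtx2 fl2_hub; congr (vtx (hub _)).
    by apply: val_inj; rewrite /= val_fl1 e3 e2 !hit_id ?K1.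
  by apply: (step y) => //; rewrite e2 hit_fl1.
Qed.

Lemma vtx_spoke k : vtx (spoke k) = vtx (old (val k)).
Proof. by rewrite -fl1_spoke vtx1. Qed.

Lemma vtx_old x y : vtx x = vtx y -> vtx (old x) = vtx (old y).
Proof.
move/vtxP; move: y.
apply: (@orbit2_ind _ fl1 fl2 (fun y => vtx (old x) = vtx (old y))) => // y _ ->.
  by rewrite vtx_old_fl1.
by rewrite -fl2_old vtx2.
Qed.

(** [star_vertex] is a complete invariant of the vertices, with [None] for the new one. [edg_star]
    and [fac_star] do the same for edges and faces, and the three counts rest on them. *)
Lemma vtx_star u v : vtx u = vtx v <-> star_vertex u = star_vertex v.
Proof.
split=> [/vtxP|].
  by move=> uv; apply/esym/(orbit2_inv star_vertex1 star_vertex2 uv).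
case: (star_flagP u) => -[x ->]; case: (star_flagP v) => -[y ->] //=.
- by case=> /vtx_old.
- by case=> /vtx_old; rewrite vtx_spoke.
- by case=> /vtx_old; rewrite vtx_spoke.
- by case=> /vtx_old; rewrite !vtx_spoke.
- by move=> _; apply: vtx_hub.
Qed.

Lemma card_vertices_star : #|vertices star| = #|vertices M|.+1.
Proof.
rewrite (@eq_card_imset _ _ _ _ star_vertex); last first.
  by move=> u v _ _; apply: vtx_star.
rewrite -[#|vertices M|](card_imset _ (@Some_inj _)) -add1n -(cards1 (None : option {set M})).
rewrite -cardsUI [X in _ = _ + X](_ : _ = 0) ?addn0.
  congr #|pred_of_set _|; apply/setP => a; apply/imsetP/setUP.
    case=> u _ ->; case: (star_flagP u) => -[x ->] /=.
    - by right; rewrite !imset_f.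
    - by right; rewrite !imset_f.
    - by left; rewrite inE.
  case=> [/set1P ->|/imsetP [_ /imsetP [x _ ->] ->]].
    by exists (hub (Sub z0 K0)).
  by exists (old x).
apply/eqP; rewrite cards_eq0; apply/eqP/setP => a; rewrite !inE.
by case: a => [a|] //=; apply/negbTE/imsetP => -[].
Qed.

Definition star_edge u : {set M} + {set M} :=
  match u with
  | inl x => inl (edg x)
  | inr (k, _) => inr [set val k; fl1 (val k)]
  end.

Lemma edg_star u v : edg u = edg v <-> star_edge u = star_edge v.
Proof.
have hub_edg k : edg (hub k) = edg (spoke k) by rewrite -fl0_spoke edg0.
have corner_edg k : edg (spoke (corner_fl1 k)) = edg (spoke k).
  by rewrite -fl2_spoke edg2.
split=> [/edgP uv|].
  apply/esym/(orbit2_inv _ _ uv) => w; case: (star_flagP w) => -[x ->] //=.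
  - by rewrite edg0.
  - by rewrite edg2.
  - by rewrite val_fl1 fl1K setUC.
  - by rewrite val_fl1 fl1K setUC.
have H k k' : [set val k; fl1 (val k)] = [set val k'; fl1 (val k')] ->
    edg (spoke k) = edg (spoke k').
  case/pair_eq => [/val_inj -> //|].
  by rewrite -val_fl1 => /val_inj ->; rewrite corner_edg.
case: (star_flagP u) => -[x ->]; case: (star_flagP v) => -[y ->] //=;
  rewrite ?hub_edg; try by case=> /H.
case=> /edgP; move: y.
apply: (@orbit2_ind _ fl0 fl2 (fun y => edg (old x) = edg (old y))) => // y _ ->.
  by rewrite -fl0_old edg0.
by rewrite -fl2_old edg2.
Qed.

Lemma card_edges_star : #|edges star| * 2 = #|edges M| * 2 + #|K|.
Proof.
rewrite (@eq_card_imset _ _ _ _ star_edge); last first.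
  by move=> u v _ _; apply: edg_star.
rewrite (@card_pairs_involution _ fl1 K); first last.
- by move=> x _; apply: fl1_neq.
- by move=> x _; apply: fl1K.
- by move=> x; rewrite K1.
rewrite -mulnDl; congr (_ * _).
rewrite -[#|edges M|](card_imset _ (@inl_inj _ {set M})).
rewrite -[#|[set _ | _ in K]|](card_imset _ (@inr_inj {set M} _)).
rewrite -cardsUI [X in _ = _ + X](_ : _ = 0) ?addn0.
  congr #|pred_of_set _|; apply/setP => a; apply/imsetP/setUP.
    case=> u _ ->; case: (star_flagP u) => -[x ->] /=.
    - by left; rewrite !imset_f.
    - by right; rewrite imset_f //; apply/imsetP; exists (val x) => //; apply: valP.
    - by right; rewrite imset_f //; apply/imsetP; exists (val x) => //; apply: valP.
  case=> /imsetP [_ /imsetP [x Kx ->] ->]; first by exists (old x).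
  by exists (hub (Sub x Kx)).
apply/eqP; rewrite cards_eq0; apply/eqP/setP => a; rewrite !inE.
by apply/negbTE/negP => /andP [/imsetP [? _ ->] /imsetP [? _]].
Qed.

(** [F] breaks up into one face per arc, recorded by the two end flags of the arc. *)
Definition star_face u : {set M} + {set M} :=
  match u with
  | inl x => if x \in F then inr [set hit x; nxt x] else inl (fac x)
  | inr (k, _) => inr [set val k; nxt (val k)]
  end.

Lemma star_face0 u : star_face (fl0 u) = star_face u.
Proof.
case: (star_flagP u) => -[x ->] //=.
by rewrite in_fac0 fac0 /nxt fl0K setUC.
Qed.

Lemma star_face1 u : star_face (fl1 u) = star_face u.
Proof.
have inF k : val k \in F by apply/KF/valP.
case: (star_flagP u) => -[x ->].
- have [Kx|nKx] := boolP (x \in K).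
    rewrite -[x]/(val (Sub x Kx : corner)) fl1_old_in /=.
    by rewrite [x \in F]KF // hit_id.
  rewrite fl1_old //= in_fac1 fac1; case: ifP => // Fx.
  by rewrite /nxt hit_fl1 // (hit_step Fx nKx) setUC.
- by rewrite fl1_spoke /= inF hit_id //; apply: valP.
- by rewrite fl1_hub /= val_nxt nxtK 1?setUC //; apply: valP.
Qed.

Lemma fac_old_hub x k : x \in F -> val k = hit x -> fac (old x) = fac (hub k).
Proof.
move=> Fx; move: x Fx k; apply: hit_ind => x.
  move=> Kx k; rewrite hit_id // => <-.
  by rewrite -fac1 fl1_old_in -fl0_hub fac0.
move=> Fx nKx IH k; rewrite hit_step // => /IH <-.
by rewrite -fl0_old fac0 -fl1_old // fac1.
Qed.

Lemma fac_star u v : fac u = fac v <-> star_face u = star_face v.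
Proof.
split=> [/facP|].
  by move=> uv; apply/esym/(orbit2_inv star_face0 star_face1 uv).
have H k k' : [set val k; nxt (val k)] = [set val k'; nxt (val k')] ->
    fac (hub k) = fac (hub k').
  case/pair_eq => [/val_inj -> //|].
  by rewrite -val_nxt => /val_inj ->; rewrite -fl1_hub fac1.
have E w : (exists2 k, fac w = fac (hub k) &
              star_face w = inr [set val k; nxt (val k)])
           \/ exists2 x, w = old x & x \notin F.
  case: (star_flagP w) => -[x ->].
  - have [Fx|nFx] := boolP (x \in F); last by right; exists x.
    have [k e] := corner_hitP Fx; left; exists k; first exact: fac_old_hub.
    by rewrite /= Fx e hit_fl0_hit.
  - by left; exists x; rewrite // -fl0_hub fac0.
  - by left; exists x.
case: (E u) => [[k -> ->]|[x -> nFx]]; case: (E v) => [[k' -> ->]|[y -> nFy]].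
- by case=> /H.
- by rewrite /= (negbTE nFy).
- by rewrite /= (negbTE nFx).
rewrite /= (negbTE nFx) (negbTE nFy) => -[] /facP; move: y nFy.
suff S y : y \in fac x -> fac (old x) = fac (old y) by move=> y _ /S.
apply: (@orbit2_ind _ fl0 fl1 (fun y => fac (old x) = fac (old y))) => // z xz ->.
  by rewrite -fl0_old fac0.
rewrite -fl1_old ?fac1 //; apply: contra nFx => /KF Fz.
by rewrite /F (facP _ _ Fz) -(facP _ _ xz) fac_refl.
Qed.

Lemma card_faces_star : #|faces star| * 2 + 2 = #|faces M| * 2 + #|K|.
Proof.
rewrite (@eq_card_imset _ _ _ _ star_face); last first.
  by move=> u v _ _; apply: fac_star.
rewrite (@card_pairs_involution _ nxt K); first last.
- exact: nxt_neq.
- exact: nxtK.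
- by move=> x Kx; apply/nxt_in/KF.
rewrite -mulnDl -[2 in LHS]mul1n -mulnDl; congr (_ * _).
rewrite (cardsD1 F (faces M)) imset_f // [_ + #|[set _ | _ in K]|]addnAC.
rewrite -[RHS]addnA addn1 add1n; congr _.+1; rewrite [RHS]addnC.
rewrite -[#|faces M :\ F|](card_imset _ (@inl_inj _ {set M})).
rewrite -[#|[set _ | _ in K]|](card_imset _ (@inr_inj {set M} _)).
rewrite -cardsUI [X in _ = _ + X](_ : _ = 0) ?addn0.
  congr #|pred_of_set _|; apply/setP => a; apply/imsetP/setUP.
    have R k : inr [set val k; nxt (val k)] \in
        (@inr {set M} {set M}) @: [set [set z; nxt z] | z in K].
      by rewrite imset_f //; apply/imsetP; exists (val k) => //; apply: valP.
    case=> u _ ->; case: (star_flagP u) => -[x ->] /=; try by right; apply: R.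
    case: ifP => Fx.
      have [k e] := corner_hitP Fx.
      by right; rewrite -(hit_fl0_hit Fx) -e; apply: R.
    left; rewrite imset_f // !inE imset_f // andbT.
    by apply: contraFneq Fx => <-; apply: fac_refl.
  case=> /imsetP [].
    move=> b; rewrite !inE => /andP [nF /imsetP [x _ e]] ->; exists (old x) => //=.
    case: ifP => [/facP Fx|]; last by rewrite e.
    by move: nF; rewrite e -Fx eqxx.
  by move=> _ /imsetP [x Kx ->] ->; exists (hub (Sub x Kx)).
apply/eqP; rewrite cards_eq0; apply/eqP/setP => a; rewrite !inE.
by apply/negbTE/negP => /andP [/imsetP [? _ ->] /imsetP [? _]].
Qed.

(** The star adds one vertex, [#|K| / 2] edges and [#|K| / 2 - 1] faces. *)
Lemma euler_char_star : euler_char star = euler_char M.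
Proof.
have := card_edges_star; have := card_faces_star; have := card_vertices_star.
by rewrite /euler_char; lia.
Qed.

(** A hub flag takes the sign of its corner flag, a spoke flag the opposite one. Conversely the
    signs are restricted to old flags; at a corner of [K] the old [fl1] is a product of three
    involutions of the star and still flips the sign. *)
Lemma orientable_star : orientable M <-> orientable star.
Proof.
split=> -[s sP].
  (* [rstep] flips the sign twice, so [nxt] flips it exactly once; this makes the signs around the
     hub alternate. *)
  have s_hit x : x \in F -> s (hit x) = s x.
    move: x; apply: hit_ind => x; first by move/hit_id->.
    move=> Fx nKx; rewrite -hit_step // => ->.
    by case: (sP (fl1 x)) => -> _ _; case: (sP x) => _ -> _; rewrite negbK.
  pose s' u := match u with
               | inl x => s x
               | inr (k, b) => if b then s (val k) else ~~ s (val k)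
               end.
  exists s' => u; case: (star_flagP u) => -[x ->].
  - case: (sP x) => e0 e1 e2; split=> //.
    have [Kx|nKx] := boolP (x \in K); last by rewrite fl1_old.
    by rewrite -[x]/(val (Sub x Kx : corner)) fl1_old_in.
  - case: (sP (val x)) => e0 e1 e2; split=> //=.
    + by rewrite negbK.
    + by rewrite negbK.
    + by rewrite val_fl1 e1.
  - case: (sP (val x)) => e0 e1 e2; split=> //=.
    + by rewrite val_nxt s_hit // in_fac0; apply/KF/valP.
    + by rewrite val_fl1 e1.
exists (s \o old) => x; case: (sP (old x)) => e0 e1 e2; split=> //=.
have [Kx|nKx] := boolP (x \in K); last by rewrite -fl1_old.
pose k : corner := Sub x Kx.
have -> : fl1 x = val (corner_fl1 k) by rewrite val_fl1.
rewrite -fl1_spoke -fl2_spoke -fl1_old_in.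
by case: (sP (fl2 (fl1 (old x)))) => _ -> _; case: (sP (fl1 (old x))) => _ _ ->; rewrite e1 !negbK.
Qed.

(** * Simplicity, potentials and kinds of faces in the star *)

Section Simple.

Hypothesis mapM : is_map M.
Hypothesis Kinj : forall z z', z \in K -> z' \in K -> vtx z = vtx z' ->
  z' = z \/ z' = fl1 z.
Hypothesis Ksurj : forall y, y \in F -> exists2 z, z \in K & vtx z = vtx y.

(** There are no double edges at the hub, since by [Kinj] two spokes with the same old end come from
    the same corner. *)
Lemma star_is_map : is_map star.
Proof.
case: mapM => _ conn noloop simple; split.
- by exists (old z0).
- pose e := [rel u v : star | [|| v == fl0 u, v == fl1 u | v == fl2 u]].
  have e0 u : connect e u (fl0 u) by apply: connect1; rewrite /= eqxx.
  have e1 u : connect e u (fl1 u) by apply: connect1; rewrite /= eqxx orbT.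
  have e2 u : connect e u (fl2 u) by apply: connect1; rewrite /= eqxx !orbT.
  have e_sym : connect_sym e.
    exact: flag_connect_sym.
  have H x y : connect e (old x) (old y).
    have /connectP [p xp ->] := conn x y.
    elim: p x xp => [|z p IH] x /=; first by rewrite connect0.
    case/andP => xz /IH; apply: connect_trans.
    case/or3P: xz => /eqP ->; [exact: (e0 (old x))| |exact: (e2 (old x))].
    have [Kx|nKx] := boolP (x \in K); last by rewrite -fl1_old.
    pose k : corner := Sub x Kx.
    have -> : fl1 x = val (corner_fl1 k) by rewrite val_fl1.
    rewrite -fl1_spoke -fl2_spoke -fl1_old_in.
    by apply: connect_trans (e1 _) (connect_trans (e2 _) (e1 _)).
  have H0 u : connect e (old z0) u.
    case: (star_flagP u) => -[x ->]; first exact: H.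
      by apply: connect_trans (H z0 (val x)) _; rewrite -fl1_old_in.
    apply: connect_trans (H z0 (val x)) _; rewrite -fl0_spoke -fl1_old_in.
    exact: connect_trans (e1 _) (e0 _).
  by move=> u v; apply: (@connect_trans _ _ (old z0)); rewrite // -/e e_sym.
- move=> u; apply/eqP => /vtx_star; case: (star_flagP u) => -[x ->] //=.
  by case=> /eqP; apply/negP.
- move=> u v /vtx_star uv /vtx_star uv0; apply/edg_star.
  have corners k k' : vtx (val k) = vtx (val k') ->
      [set val k; fl1 (val k)] = [set val k'; fl1 (val k')].
    by case/(Kinj (valP k) (valP k')) => -> //; rewrite fl1K setUC.
  move: uv uv0; case: (star_flagP u) => -[x ->]; case: (star_flagP v) => -[y ->] //=.
  + by case=> xy [xy0]; congr inl; apply: simple.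
  + by case=> xy _; congr inr; apply: corners.
  + by move=> _ [xy]; congr inr; apply: corners.
Qed.

Lemma adj_old x y : adj (vtx x) (vtx y) -> adj (vtx (old x)) (vtx (old y)).
Proof.
by case/adjP => z /vtx_old xz /vtx_old yz; apply/adjP; exists (old z).
Qed.

Lemma adj_hub k y : y \in F -> adj (vtx (hub k)) (vtx (old y)).
Proof.
case/Ksurj => z Kz /vtx_old zy; apply/adjP; exists (hub (Sub z Kz)).
  exact: vtx_hub.
by rewrite fl0_hub vtx_spoke.
Qed.

Definition lift_vertex (a : {set M}) : {set star} :=
  [set u | star_vertex u == Some a].

Lemma lift_vtx x : lift_vertex (vtx x) = vtx (old x).
Proof.
apply/setP => u; rewrite inE; apply/eqP/vtxP => [e|/vtx_star <- //].
by apply/vtx_star.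
Qed.

Lemma lift_vertex_inj a b :
  a \in vertices M -> b \in vertices M -> lift_vertex a = lift_vertex b -> a = b.
Proof.
by case/imsetP=> x _ -> /imsetP [y _ ->]; rewrite !lift_vtx => /vtx_star [].
Qed.

Lemma adj_vertex (N : flag_system) (a b : {set N}) : adj a b -> b \in vertices N.
Proof. by case/adjP => x _ <-; apply/imsetP; exists (fl0 x). Qed.

Lemma hub_not_lifted k (A : {set {set M}}) : {subset A <= vertices M} ->
  vtx (hub k) \notin lift_vertex @: A.
Proof.
move=> Av; apply/imsetP => -[a /Av /imsetP [x _ ->]].
by rewrite lift_vtx => /vtx_star.
Qed.

(** Old common neighbours lift injectively. By [Ksurj] the hub is joined to both ends of every edge
    of [F], and it is not a lifted vertex. *)
Lemma common_star x :
  #|common x| + ((x \in F) || (fl2 x \in F)) <= #|common (old x)|.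
Proof.
have cv : {subset common x <= vertices M}.
  by move=> c; rewrite inE => /andP [/adj_vertex].
pose k : corner := Sub z0 K0.
have lifted : lift_vertex @: common x \subset common (old x).
  apply/subsetP => _ /imsetP [c cx ->]; have /imsetP [y _ e] := cv _ cx.
  move: cx; rewrite !inE e lift_vtx fl0_old => /andP [xy yx].
  by rewrite !adj_old.
rewrite -(card_in_imset (f := lift_vertex) (D := mem (common x))); last first.
  by move=> a b /cv av /cv bv; apply: lift_vertex_inj.
have [xF|_] := boolP ((x \in F) || (fl2 x \in F)); last by rewrite addn0 subset_leq_card.
rewrite addnC.
have -> : true + #|lift_vertex @: common x| =
    #|vtx (hub k) |: lift_vertex @: common x|.
  by rewrite cardsU1 hub_not_lifted.
apply: subset_leq_card; rewrite subUset lifted andbT sub1set inE.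
have H y : y \in F -> adj (vtx (hub k)) (vtx (old y)) &&
    adj (vtx (hub k)) (vtx (old (fl0 y))).
  by move=> Fy; rewrite !adj_hub ?in_fac0.
rewrite adj_sym fl0_old; case/orP: xF => /H //.
by rewrite fl02C -!fl2_old !vtx2.
Qed.

Lemma tri_old_out x : x \notin F -> tri (old x) = tri x.
Proof.
have nK y : y \notin F -> y \notin K by apply: contra; apply: KF.
move=> nFx; rewrite !triE !(fl0_old, fl1_old) ?nK ?in_fac0 ?in_fac1 ?in_fac0 //.
Qed.

(** Compare the two sides of [triE]: unless both ends of the edge are in [K], they are flags of
    different types, or their equality means [tri x]. *)
Lemma tri_old_in x : x \in F -> ~~ tri x -> tri (old x) -> x \in K /\ fl0 x \in K.
Proof.
move=> Fx; rewrite !triE fl0_old => nt /eqP.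
have [Kx|nKx] := boolP (x \in K).
  rewrite -[x]/(val (Sub x Kx : corner)) fl1_old_in.
  have [K0x //|nK0x] := boolP (fl0 x \in K).
  by rewrite fl0_spoke fl1_hub [fl1 (old _)]fl1_old.
rewrite [fl1 (old x)]fl1_old // fl0_old.
have old1 y : {k | fl1 (old y) = spoke k} + {fl1 (old y) = old (fl1 y)}.
  case: (boolP (y \in K)) => [Ky|nKy]; last by right; rewrite fl1_old.
  by left; exists (Sub y Ky); rewrite -fl1_old_in.
case: (old1 (fl0 x)) => [[k ->]|->].
  by rewrite fl0_spoke; case: (old1 (fl0 (fl1 x))) => [[? ->]|->].
case: (old1 (fl0 (fl1 x))) => [[? ->] //|->].
by rewrite fl0_old => /old_inj /eqP; rewrite (negbTE nt).
Qed.

Lemma tri_old x : x \in K -> fl0 x \in K -> tri (old x).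
Proof.
move=> Kx K0x; rewrite triE fl0_old.
rewrite -{1}[x]/(val (Sub x Kx : corner)) -[fl0 x]/(val (Sub (fl0 x) K0x : corner)).
rewrite !fl1_old_in !fl0_spoke fl1_hub; apply/eqP; congr hub; apply: val_inj.
by rewrite val_nxt /nxt hit_id.
Qed.

Hypothesis nontri : ~~ tri z0.
Hypothesis noback : forall z, z \in F -> vtx (fl0 z) <> vtx (fl0 (fl1 z)).

(** The gain of the hub pays for one lost side. Both sides can be lost only if [F] lies on both
    sides of the edge and [x] and [fl2 x] are both in [K]; then [Kinj] gives [fl2 x = fl1 x], and
    the walk turns back at [x], against [noback]. *)
Lemma pot_old x : 3 <= pot x -> 3 <= pot (old x).
Proof.
have ntF y : y \in F -> ~~ tri y by move/tri_fac->.
have := common_star x; rewrite /pot fl2_old.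
have [Fx|nFx] := boolP (x \in F); have [F2x|nF2x] := boolP (fl2 x \in F) => /=.
- rewrite (ntF _ Fx) (ntF _ F2x).
  have [t1|] := boolP (tri (old x)); last by case: (tri (old (fl2 x))) => /=; lia.
  have [t2|] := boolP (tri (old (fl2 x))); last by lia.
  have [Kx K0x] := tri_old_in Fx (ntF _ Fx) t1.
  have [K2x K02x] := tri_old_in F2x (ntF _ F2x) t2.
  case: (Kinj Kx K2x); first by rewrite vtx2.
    by move=> e; have := fl2_neq x; rewrite e eqxx.
  move=> e; case: (noback Fx).
  by rewrite -e fl02C vtx2.
- by rewrite (ntF _ Fx) (tri_old_out nF2x); case: (tri (old x)) => /=; lia.
- by rewrite (ntF _ F2x) (tri_old_out nFx); case: (tri (old (fl2 x))) => /=; lia.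
- by rewrite !tri_old_out //; lia.
Qed.

Definition face_nbrs z : {set {set M}} := [set a in @vtx M @: F | adj (vtx z) a].

(** The neighbours on [F] of the old end of the spoke are also neighbours of the hub. If an adjacent
    corner of the walk is not in [K], the new face on that side is not a triangle and supplies the
    missing unit. *)
Lemma pot_spoke k :
  3 <= #|face_nbrs (val k)| \/
  2 <= #|face_nbrs (val k)| /\ ((fl0 (val k) \notin K) || (fl0 (fl1 (val k)) \notin K)) ->
  3 <= pot (spoke k).
Proof.
have cn : #|face_nbrs (val k)| <= #|common (spoke k)|.
  have cv : {subset face_nbrs (val k) <= vertices M}.
    by move=> c; rewrite inE => /andP [_ /adj_vertex].
  rewrite -(card_in_imset (f := lift_vertex) (D := mem (face_nbrs (val k)))); last first.
    by move=> a b /cv av /cv bv; apply: lift_vertex_inj.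
  apply/subset_leq_card/subsetP => _ /imsetP [a + ->].
  rewrite !inE => /andP [/imsetP [y Fy ->] ky].
  by rewrite lift_vtx fl0_spoke vtx_spoke adj_old // adj_sym adj_hub.
have ntF y : y \in F -> ~~ tri y by move/tri_fac->.
have Fk k' : val k' \in F by apply/KF/valP.
rewrite /pot; case=> [|[c2 /orP b]]; first by lia.
suff : ~~ tri (spoke k) \/ ~~ tri (fl2 (spoke k)) by case=> /negbTE ->; lia.
case: b => n0; [left|right].
  rewrite -tri_fl1 fl1_spoke; apply: contra n0 => /(tri_old_in (Fk _)).
  by case; rewrite ?ntF.
rewrite fl2_spoke -tri_fl1 fl1_spoke; apply: contra n0 => /(tri_old_in (Fk _)).
by case; rewrite ?ntF // val_fl1.
Qed.

(** Otherwise [Kinj] forces [nxt z = fl1 z], so [z] and [fl1 z] are the only flags of [K]. By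
    [Ksurj] all of [F] is then at the vertex of [z], and an edge of [F] is a loop. *)
Lemma nxt_vtx z : z \in K -> vtx z <> vtx (nxt z).
Proof.
move=> Kz e; have Fz := KF Kz.
have nz : nxt z = fl1 z.
  case: (Kinj Kz (nxt_in Fz) e) => // e'.
  by have := nxt_neq Kz; rewrite e' eqxx.
have all_z x : x \in F -> hit x \in [:: z; fl1 z].
  have n y : y \in F -> hit y \in [:: z; fl1 z] -> hit (fl0 y) \in [:: z; fl1 z].
    move=> Fy; rewrite -/(nxt y) -(hit_fl0_hit Fy) !inE => /orP [] /eqP ->.
      by rewrite nz eqxx orbT.
    by rewrite -nz nxtK // eqxx.
  rewrite {1}/F (facP _ _ Fz).
  move: x; apply: orbit2_ind; first by rewrite hit_id // inE eqxx.
  - by move=> y; rewrite -/(fac z) -(facP _ _ Fz) => Fy; apply: n.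
  - move=> y; rewrite -/(fac z) -(facP _ _ Fz) => Fy; have [Ky|nKy] := boolP (y \in K).
      by rewrite !hit_id ?K1 // !inE => /orP [] /eqP ->; rewrite ?fl1K eqxx ?orbT.
    by rewrite hit_fl1 //; apply: n.
have [|z' Kz' e'] := Ksurj (y := fl0 z); first by rewrite in_fac0.
have := all_z z' (KF Kz'); rewrite hit_id // => z'z.
case: mapM => _ _ /(_ z) /eqP []; rewrite -e'.
by move: z'z; rewrite !inE => /orP [] /eqP ->; rewrite ?vtx1.
Qed.

Variable P : {set M}.
Hypothesis FP : forall y, y \in F -> y \notin K -> y \in P.

(* The corners of [P] not yet joined to a new vertex; their number decreases. *)
Definition star_pristine : {set star} := old @: (P :\: K).

(** The six excepted flags are the hub flags, the spoke flags and the old flags of [K] at the two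
    ends of the arc. All other flags of the face are old and outside [K]. *)
Lemma hat_hub k : hat star_pristine (hub k).
Proof.
have faceE (y : star) : y \in fac (hub k) -> star_face y = inr [set val k; nxt (val k)].
  by move/facP/fac_star => <-.
have cornerE k' : [set val k'; nxt (val k')] = [set val k; nxt (val k)] ->
    k' = k \/ k' = corner_nxt k.
  move/esym/pair_eq.
  by case=> [/val_inj ->|]; [left|rewrite -val_nxt => /val_inj ->; right].
split.
- rewrite fl0_hub fl1_hub fl0_hub => /vtx_star [].
  by rewrite val_nxt; apply: nxt_vtx; apply: valP.
- move=> y /faceE yE; rewrite fl1_hub !inE negb_or.
  move: yE; case: (star_flagP y) => -[x ->] /=.
  + by case: ifP => // Fx _ _; apply: adj_hub.
  + by move=> _ _; rewrite vtx_spoke adj_hub //; apply/KF/valP.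
  + by case=> /cornerE [] ->; rewrite eqxx ?andbF.
- move=> y /faceE yE; rewrite fl0_hub fl1_spoke fl1_hub fl0_hub fl1_spoke.
  rewrite !inE !negb_or => /and5P [n1 n2 n3 n4 /andP [n5 n6]].
  move: yE n1 n2 n3 n4 n5 n6; case: (star_flagP y) => -[x ->].
  + rewrite [star_face _]/=; case: ifP => // Fx [].
    have [Kx|nKx] := boolP (x \in K).
      rewrite hit_id // -[x]/(val (Sub x Kx : corner)).
      by case/cornerE=> ->; rewrite ?eqxx.
    by move=> *; rewrite imset_f // inE nKx FP.
  + by case=> /cornerE [] ->; rewrite eqxx.
  + by case=> /cornerE [] ->; rewrite eqxx.
Qed.

Lemma face_kind_star : (forall x, face_kind P x) -> forall u, face_kind star_pristine u.
Proof.
move=> Pk u.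
have [Fu|[x -> nFx]] : (exists k, fac u = fac (hub k)) \/ exists2 x, u = old x & x \notin F.
  case: (star_flagP u) => -[x ->].
  - have [Fx|nFx] := boolP (x \in F); last by right; exists x.
    by have [k /(fac_old_hub Fx) e] := corner_hitP Fx; left; exists k.
  - by left; exists x; rewrite -fl0_hub fac0.
  - by left; exists x.
- case: Fu => k e; constructor 3; exists (hub k); last exact: hat_hub.
  by rewrite e fac_refl.
have facE y v : y \notin F -> v \in fac (old y) ->
    exists2 y', v = old y' & y' \in fac y.
  move=> nFy /facP/fac_star; rewrite /= (negbTE nFy).
  case: (star_flagP v) => -[z ->] //=; case: ifP => // _ [] e; exists z => //.
  by apply/facP.
have nK y : y \notin F -> y \notin K by apply: contra; apply: KF.
have nF y z : y \notin F -> z \in fac y -> z \notin F.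
  move=> nFy /facP yz; apply: contra nFy => /facP Fz.
  by apply/facP; rewrite Fz yz.
case: (Pk x) => [t|xP|[z xz [h1 h2 h3]]].
- by constructor 1; rewrite tri_old_out.
- constructor 2 => v /(facE _ _ nFx) [y -> xy].
  by rewrite imset_f // inE xP // nK //; apply: nF xy.
have nFz := nF _ _ nFx xz.
constructor 3; exists (old z).
  by apply/facP/fac_star; rewrite /= (negbTE nFx) (negbTE nFz) (facP _ _ xz).
have mem y s : (old y \in map old s) = (y \in s) by rewrite (mem_map old_inj).
have fl1E : fl1 (old z) = old (fl1 z) by rewrite fl1_old // nK.
split.
- by rewrite fl1E !fl0_old => /vtx_star [].
- move=> v /(facE _ _ nFz) [y -> zy]; rewrite fl1E (mem y [:: z; fl1 z]).
  by move=> ny; apply/adj_old/h2.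
- move=> v /(facE _ _ nFz) [y -> zy].
  rewrite fl1E !fl0_old !fl1_old ?nK ?in_fac0 ?in_fac1 //.
  rewrite (mem y [:: z; _; _; _; _; _]) => /h3 yP.
  by rewrite imset_f // inE yP // nK //; apply: nF zy.
Qed.

End Simple.

(** Each corner of [K] met by a rotation costs one more step, across its spoke. No new edge joins
    two vertices of the image, because its hub end is not in the image. *)
Lemma submap_star (G : flag_system) (phi : G -> M) :
  submap phi -> submap (old \o phi).
Proof.
case=> inj comm skip clos; split.
- by move=> x y /old_inj /inj.
- by move=> x /=; rewrite !(comm x).1 !(comm x).2.
- pose Q v := forall y : G, (old \o phi) y <> v.
  (* Rotation from [v] to [w], all flags before [w] being outside the image. *)
  pose R (v w : star) := exists n, w = iter n (fl1 \o fl2) v /\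
    forall i, i < n -> Q (iter i (fl1 \o fl2) v).
  have RS v w : Q v -> R (fl1 (fl2 v)) w -> R v w.
    move=> Qv [n [-> nQ]]; exists n.+1; split; first by rewrite iterSr.
    by case=> [|k] //; rewrite ltnS iterSr => /nQ.
  have R0 v : R v v by exists 0.
  have Qspoke k : Q (spoke k) by [].
  have R1 y w : R (old (fl1 y)) w -> R (fl1 (old y)) w.
    have [Ky|nKy] := boolP (y \in K); last by rewrite fl1_old.
    pose k : corner := Sub y Ky.
    have -> : fl1 y = val (corner_fl1 k) by rewrite val_fl1.
    rewrite -fl1_spoke -fl2_spoke -[y]/(val k) fl1_old_in.
    by apply: RS.
  move=> x; have [n [e nim]] := skip x; apply: (R1); rewrite /= e.
  move: (fl1 (phi x)) nim => y; elim: n y {e} => [|n IH] y nim; first exact: R0.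
  rewrite iterSr; apply: RS.
    by move=> z /old_inj; apply: (nim 0).
  rewrite fl2_old; apply: R1; apply: IH => k kn z.
  by have := nim k.+1 kn z; rewrite iterSr.
- move=> u [x0 e0] [x1 e1]; move: e0 e1; case: (star_flagP u) => -[y ->].
  + rewrite fl0_old => /vtx_star [e0] /vtx_star [e1].
    by case: (clos y) => [||x <-]; [exists x0|exists x1|exists x].
  + by rewrite fl0_spoke => _ /vtx_star.
  + by move=> /vtx_star.
Qed.

End Star.

(** * Choosing one corner for each vertex of a face *)

Section Transversals.

Variable M : flag_system.
Hypothesis mapM : is_map M.
Implicit Types (x y z : M) (K P : {set M}).

Lemma noloop x : vtx x <> vtx (fl0 x).
Proof. by case: mapM => _ _ /(_ x) /eqP. Qed.

Lemma adj_irrefl (a b : {set M}) : adj a b -> a <> b.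
Proof. by case/adjP => x <- <-; apply: noloop. Qed.

Definition face_transversal x K : Prop :=
  [/\ {subset K <= fac x},
      forall z, (fl1 z \in K) = (z \in K),
      forall z z', z \in K -> z' \in K -> vtx z = vtx z' -> z' = z \/ z' = fl1 z
    & forall y, y \in fac x -> exists2 z, z \in K & vtx z = vtx y].

Lemma transversal_extend x K :
  {subset K <= fac x} -> (forall z, (fl1 z \in K) = (z \in K)) ->
  (forall z z', z \in K -> z' \in K -> vtx z = vtx z' -> z' = z \/ z' = fl1 z) ->
  exists2 K' : {set M}, K \subset K' & face_transversal x K'.
Proof.
move=> KF K1 Kinj.
(* The default [x] is never taken, since [r] is only used at vertices of the face. *)
pose r a : M := odflt x [pick y in fac x | vtx y == a].
have rP y : y \in fac x -> r (vtx y) \in fac x /\ vtx (r (vtx y)) = vtx y.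
  move=> Fy; rewrite /r; case: pickP => [z /andP [-> /eqP ->] //|/(_ y)].
  by rewrite Fy eqxx.
pose new z := [&& z \in fac x, vtx z \notin @vtx M @: K &
                  (z == r (vtx z)) || (z == fl1 (r (vtx z)))].
exists [set z | (z \in K) || new z].
  by apply/subsetP => z; rewrite inE => ->.
split.
- by move=> z; rewrite inE => /orP [/KF //|/and3P []].
- move=> z; rewrite !inE K1 /new in_fac1 vtx1.
  congr (_ || (_ && (_ && _))); rewrite orbC; congr (_ || _).
    by rewrite (inj_eq (can_inj (@fl1K M))).
  by rewrite (can2_eq (@fl1K M) (@fl1K M)).
- move=> z z'; rewrite !inE => /orP [Kz|/and3P [_ nz rz]] /orP [Kz'|/and3P [_ nz' rz']] e.
  + exact: Kinj.
  + by move: nz'; rewrite -e imset_f.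
  + by move: nz; rewrite e imset_f.
  + move: rz rz'; rewrite e; move: (r (vtx z')) => t {e nz nz'} /orP [] /eqP -> /orP [] /eqP ->; rewrite ?fl1K; auto.
- move=> y Fy; have [Ky|nKy] := boolP (vtx y \in @vtx M @: K).
    by case/imsetP: Ky => z Kz ->; exists z; rewrite // inE Kz.
  have [Fr er] := rP y Fy; exists (r (vtx y)); rewrite // inE /new.
  by rewrite Fr er nKy eqxx orbT.
Qed.

(** Irreducibility at a single corner: its two neighbours on the walk are adjacent. *)
Definition chordal z := adj (vtx (fl0 z)) (vtx (fl0 (fl1 z))).

(* The edge from the corner [z] to the new vertex of a star survives: it has
   three common neighbours, or two and a non-triangular side. *)
Definition good_corner x K z : Prop :=
  3 <= #|face_nbrs x z| \/
  2 <= #|face_nbrs x z| /\ ((fl0 z \notin K) || (fl0 (fl1 z) \notin K)).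

Lemma mem_face_nbrs x y z :
  y \in fac x -> adj (vtx z) (vtx y) -> vtx y \in face_nbrs x z.
Proof. by move=> Fy zy; rewrite inE zy imset_f. Qed.

(** * Hatted faces *)

Section Hat.

Variable P : {set M}.
Hypothesis Pchordal : forall y, y \in P -> chordal y.

Lemma hat_fl1 z : hat P z -> hat P (fl1 z).
Proof.
case=> h1 h2 h3; rewrite /hat fac1 vtx1 fl1K; split.
- by move/esym.
- by move=> y Fy ny; apply: h2 => //; apply: contra ny; rewrite !inE orbC.
- move=> y Fy ny; apply: h3 => //; apply: contra ny; rewrite !inE.
  by do 5?[case/orP]; move=> ->; rewrite ?orbT.
Qed.

Variable z : M.
Hypotheses (hz : hat P z) (ntz : ~~ tri z).

Definition hat2 x : M := fl1 (fl0 (fl1 (fl0 x))).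

Lemma hat2_fac : hat2 z \in fac z.
Proof. by rewrite /hat2 !(in_fac0, in_fac1) fac_refl. Qed.

(** A coincidence would produce a loop, a fixed point of an involution, a triangle, or equal
    vertices on the two sides of the hat. *)
Lemma hat2_notin :
  hat2 z \notin [:: z; fl1 z; fl0 z; fl1 (fl0 z); fl0 (fl1 z); fl1 (fl0 (fl1 z))].
Proof.
case: hz => h1 _ _; rewrite !inE !negb_or.
have nv : vtx (fl0 z) <> vtx (hat2 z).
  by rewrite /hat2 !vtx1 -(vtx1 (fl0 z)); apply: noloop.
have inj1 := can_inj (@fl1K M); have inj0 := can_inj (@fl0K M).
apply/and5P; split; last (apply/andP; split); apply/eqP => e.
- apply: h1; rewrite -[z in RHS]e /hat2 fl1K fl0K vtx1 //.
- have /eqP[] := fl1_neq (fl0 z).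
  by apply: inj0; rewrite fl0K; apply: inj1.
- by rewrite e in nv.
- by apply: nv; rewrite e vtx1.
- by move: ntz; rewrite -tri_fl0 triE fl0K -e eqxx.
- by have /eqP[] := fl0_neq z; apply/inj1/inj0/inj1.
Qed.

Lemma hat2P : hat2 z \in P.
Proof. by case: hz => _ _; apply; [apply: hat2_fac|apply: hat2_notin]. Qed.

(** The four consecutive vertices starting at the hat span a complete graph: the hat is adjacent to
    the others, and chordality at [hat2 z] provides the last edge. *)
Lemma hat2_adj : [/\ adj (vtx z) (vtx (fl0 z)), adj (vtx z) (vtx (hat2 z))
  & adj (vtx z) (vtx (fl0 (hat2 z)))] /\ [/\ adj (vtx (fl0 z)) (vtx (hat2 z)),
  adj (vtx (fl0 z)) (vtx (fl0 (hat2 z))) & adj (vtx (hat2 z)) (vtx (fl0 (hat2 z)))].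
Proof.
case: hz => _ h2 _; have := hat2_notin; rewrite !inE !negb_or.
case/and5P => n1 n2 n3 n4 /andP [n5 n6].
have inj0 := can_inj (@fl0K M).
split; split; rewrite ?adj_fl0 //.
- by apply: h2; rewrite ?hat2_fac // !inE negb_or n1.
- apply: h2; rewrite ?in_fac0 ?hat2_fac // !inE negb_or.
  by rewrite !(can2_eq (@fl0K M) (@fl0K M)) n3.
- by rewrite /hat2 !vtx1 -(vtx1 (fl0 z)) adj_fl0.
- rewrite adj_sym; have := Pchordal hat2P; rewrite /chordal.
  by rewrite {2}/hat2 fl1K fl0K vtx1.
Qed.

End Hat.

Section HatFace.

Variables (P : {set M}) (z : M).
Hypothesis Pchordal : forall y, y \in P -> chordal y.
Hypotheses (hz : hat P z) (ntz : ~~ tri z).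

Let hz1 : hat P (fl1 z) := hat_fl1 hz.
Let ntz1 : ~~ tri (fl1 z). Proof. by rewrite tri_fl1. Qed.

Lemma hat_cases y : y \in fac z ->
  [\/ y \in [:: z; fl1 z], y \in [:: fl0 z; fl1 (fl0 z)],
      y \in [:: fl0 (fl1 z); fl1 (fl0 (fl1 z))]
    | y \in P /\ y \notin [:: z; fl1 z; fl0 z; fl1 (fl0 z); fl0 (fl1 z); fl1 (fl0 (fl1 z))]].
Proof.
move=> Fy; case: hz => _ _ h3.
have [|ny] := boolP (y \in [:: z; fl1 z; fl0 z; fl1 (fl0 z); fl0 (fl1 z); fl1 (fl0 (fl1 z))]).
  rewrite !inE => /or4P [| | |/or3P []] ->; rewrite ?orbT;
  by [constructor 1|constructor 1|constructor 2|constructor 2|constructor 3|constructor 3].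
by constructor 4; split=> //; apply: h3.
Qed.

(** At the hat this is part of [hat]; next to the hat it follows from [hat2_adj]; elsewhere the two
    vertices are adjacent by chordality. *)
Lemma hat_noback y : y \in fac z -> vtx (fl0 y) <> vtx (fl0 (fl1 y)).
Proof.
have sym t : vtx (fl0 t) <> vtx (fl0 (fl1 t)) ->
    forall s, s \in [:: t; fl1 t] -> vtx (fl0 s) <> vtx (fl0 (fl1 s)).
  by move=> nt s; rewrite !inE => /orP [] /eqP -> //; rewrite fl1K => /esym.
have spoke0 t : hat P t -> ~~ tri t -> vtx (fl0 (fl0 t)) <> vtx (fl0 (fl1 (fl0 t))).
  move=> ht nt; have [[_ a _] _] := hat2_adj Pchordal ht nt.
  by rewrite fl0K -(vtx1 (fl0 (fl1 _))); apply: adj_irrefl.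
case/hat_cases.
- by apply: sym; case: hz.
- by apply: sym; apply: spoke0.
- by apply: sym; apply: spoke0.
- by case=> /Pchordal /adj_irrefl.
Qed.

(** At the hat and next to it, use the complete graph of [hat2_adj]. At any other corner the hat and
    the two neighbours on the walk are pairwise adjacent. *)
Lemma hat_face_nbrs y : y \in fac z -> 3 <= #|face_nbrs z y|.
Proof.
have nbrs3 s a b c : s \in fac z -> a \in fac z -> b \in fac z -> c \in fac z ->
    adj (vtx s) (vtx a) -> adj (vtx s) (vtx b) -> adj (vtx s) (vtx c) ->
    vtx a <> vtx b -> vtx a <> vtx c -> vtx b <> vtx c -> 3 <= #|face_nbrs z s|.
  move=> Fs Fa Fb Fc sa sb sc /eqP ab /eqP ac /eqP bc.
  by apply: (card_ge3 _ _ _ ab ac bc); apply: mem_face_nbrs.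
have Fz := fac_refl z.
have nbrs_vtx s t : vtx s = vtx t -> face_nbrs z s = face_nbrs z t.
  by rewrite /face_nbrs => ->.
have spoke3 t : t \in fac z -> hat P t -> ~~ tri t ->
    3 <= #|face_nbrs z t| /\ 3 <= #|face_nbrs z (fl0 t)|.
  move=> Ft ht nt; have [[a1 a2 a3] [a4 a5 a6]] := hat2_adj Pchordal ht nt.
  have F2 : hat2 t \in fac z by rewrite (facP _ _ Ft) hat2_fac.
  split.
    by apply: (nbrs3 _ (fl0 t) (hat2 t) (fl0 (hat2 t)));
      rewrite ?in_fac0 //; apply: adj_irrefl.
  apply: (nbrs3 _ t (hat2 t) (fl0 (hat2 t))); rewrite ?in_fac0 //;
    try exact: adj_irrefl.
  by rewrite adj_sym.
move=> Fy; case: (hat_cases Fy).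
- have [H _] := spoke3 z Fz hz ntz.
  by rewrite !inE => /orP [] /eqP ->; rewrite // (nbrs_vtx _ z) ?vtx1.
- have [_ H] := spoke3 z Fz hz ntz.
  by rewrite !inE => /orP [] /eqP ->; rewrite // (nbrs_vtx _ (fl0 z)) ?vtx1.
- have [|_ H] := spoke3 (fl1 z) _ hz1 ntz1; first by rewrite in_fac1.
  by rewrite !inE => /orP [] /eqP ->; rewrite // (nbrs_vtx _ (fl0 (fl1 z))) ?vtx1.
case=> /Pchordal cy; rewrite !inE !negb_or => /and5P [n1 n2 n3 n4 /andP [n5 n6]].
case: hz => _ h2 _.
have a0 : adj (vtx z) (vtx y) by apply: h2; rewrite // !inE negb_or n1.
have a1 : adj (vtx z) (vtx (fl0 y)).
  apply: h2; rewrite ?in_fac0 // !inE negb_or.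
  by rewrite !(can2_eq (@fl0K M) (@fl0K M)) n3.
have a2 : adj (vtx z) (vtx (fl0 (fl1 y))).
  apply: h2; rewrite ?in_fac0 ?in_fac1 // !inE negb_or.
  by rewrite !(can2_eq (@fl0K M) (@fl0K M)) !(can2_eq (@fl1K M) (@fl1K M)) n4.
apply: (nbrs3 _ z (fl0 y) (fl0 (fl1 y))); rewrite ?in_fac0 ?in_fac1 ?adj_fl0 //;
  try exact: adj_irrefl.
- by rewrite adj_sym.
- by rewrite -(vtx1 y) adj_fl0.
Qed.

(** The corners at the hat and next to it must be taken, as they need not be in [P]. The face has a
    fourth vertex, and its chosen corner lies in [P], so that filling uses up part of [P]. *)
Lemma hat_transversal : exists K,
  [/\ face_transversal z K, z \in K, forall y, y \in fac z -> y \notin K -> y \in P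
    & exists2 y, y \in K & y \in P].
Proof.
pose s := [:: z; fl1 z; fl0 z; fl1 (fl0 z); fl0 (fl1 z); fl1 (fl0 (fl1 z))].
pose K0 := [set y in s].
have [[a1 a2 a3] [a4 a5 a6]] := hat2_adj Pchordal hz ntz.
have h1 : vtx (fl0 z) <> vtx (fl0 (fl1 z)) by case: hz.
have n0 := adj_irrefl a1.
have n1 : vtx z <> vtx (fl0 (fl1 z)) by rewrite -(vtx1 z); apply: noloop.
have KP y : y \in fac z -> y \notin K0 -> y \in P.
  by case: hz => _ _ h3 Fy; rewrite inE => /h3; apply.
have [|||K K0K [KF K1 Kinj Ksurj]] := @transversal_extend z K0.
- move=> y; rewrite inE; move: y; apply/allP => /=.
  by rewrite !(in_fac0, in_fac1) fac_refl.
- move=> y; rewrite !inE !(can2_eq (@fl1K M) (@fl1K M)) !fl1K.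
  by do !case: (_ == _).
- have nn0 := nesym n0; have nn1 := nesym n1; have hh1 := nesym h1.
  move=> y y'; rewrite !inE.
  by do 2![case/or4P => [| | |/or3P []] /eqP ->]; rewrite ?vtx1 ?fl1K; auto.
exists K; split=> //.
- by apply: (subsetP K0K); rewrite !inE eqxx.
- by move=> y Fy nKy; apply: KP => //; apply: contra nKy; apply: (subsetP K0K).
suff [y [Fy e1 e2 e3]] : exists y, [/\ y \in fac z, vtx y <> vtx z,
    vtx y <> vtx (fl0 z) & vtx y <> vtx (fl0 (fl1 z))].
  have [t Kt e] := Ksurj y Fy; exists t => //; apply: KP; first exact: KF.
  rewrite !inE; apply/negP => /or4P [| | |/or3P []] /eqP et;
    by move: e e1 e2 e3; rewrite et ?vtx1 => <-.
(* If [hat2 z] is at the far neighbour of the hat, the next corner has the fourth vertex, by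
   [hat2_adj]. *)
have [e|/eqP ne] := eqVneq (vtx (hat2 z)) (vtx (fl0 (fl1 z))).
  exists (fl0 (hat2 z)); rewrite in_fac0 hat2_fac -e.
  by split=> //; apply: nesym; apply: adj_irrefl.
exists (hat2 z); rewrite hat2_fac; split=> //; by apply: nesym; apply: adj_irrefl.
Qed.

End HatFace.

(** * Untouched large faces *)

Section RootFace.

Variable x : M.
Hypotheses (ntx : ~~ tri x) (xchordal : forall y, y \in fac x -> chordal y).

Let s := @face_step M.

Lemma fl1_face_step y : fl1 (s y) = fl0 y.
Proof. by rewrite /s /face_step fl1K. Qed.

Lemma fl0_fl1_face_step y : fl0 (fl1 (s y)) = y.
Proof. by rewrite fl1_face_step fl0K. Qed.

Lemma iter_face_fac i y : y \in fac x -> iter i s y \in fac x.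
Proof. by move=> Fy; elim: i => //= i IH; rewrite in_fac1 in_fac0. Qed.

(** An equality could be shortened at both ends until [fl0] or [fl1] has a fixed point. *)
Lemma face_walk_oriented n y : iter n s y <> fl1 y.
Proof.
elim/ltn_ind: n y => -[|[|n]] IH y /=; first by apply/eqP; rewrite eq_sym fl1_neq.
  by move=> /(can_inj (@fl1K M)) /eqP; rewrite (negbTE (fl0_neq y)).
move=> /(can_inj (@fl1K M)) e; apply: (IH n _ (s y)); first by lia.
by rewrite fl1_face_step -iterSr; apply: (can_inj (@fl0K M)); rewrite fl0K.
Qed.

Lemma face_walk_oriented2 i j y : iter i s y <> fl1 (iter j s y).
Proof.
case: (leqP j i) => ij.
  by rewrite -(subnK ij) iterD; apply: face_walk_oriented.
move=> e; apply: (@face_walk_oriented (j - i) (iter i s y)).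
by rewrite -iterD subnK 1?ltnW // e fl1K.
Qed.

Lemma face_walk_cover y z : y \in fac x -> z \in fac x ->
  exists2 i, i < face_size y & z = iter i s y \/ z = fl1 (iter i s y).
Proof.
move=> Fy; have m0 : 0 < face_size y by apply: order_gt0.
have per : iter (face_size y) s y = y by apply: iter_order; apply: face_step_inj.
rewrite (facP _ _ Fy) => Fz.
have mod i : iter (i %% face_size y) s y = iter i s y.
  rewrite [in RHS](divn_eq i (face_size y)) addnC iterD; congr (iter _ _ _).
  by elim: (_ %/ _) => //= n IH; rewrite mulSn iterD -IH per.
suff [i zi] : exists i, z = iter i s y \/ z = fl1 (iter i s y).
  by exists (i %% face_size y); rewrite ?ltn_mod // mod.
move: z Fz; apply: orbit2_ind; first by exists 0; left.
- move=> t _ [i [->|->]]; first by exists i.+1; right; rewrite iterS fl1_face_step.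
  (* One step back is taken as [face_size y - 1] steps forward. *)
  exists (i + (face_size y).-1); left.
  by rewrite -[in LHS]per -iterD -(prednK m0) addnS iterS fl0_fl1_face_step.
- by move=> t _ [i [->|->]]; exists i; rewrite ?fl1K; auto.
Qed.

Lemma root_nbrs2 y : y \in fac x -> 2 <= #|face_nbrs x y|.
Proof.
move=> Fy; have /adj_irrefl ne := xchordal Fy.
have -> : 2 = #|[set vtx (fl0 y); vtx (fl0 (fl1 y))]| by rewrite cards2; move/eqP: ne => ->.
apply/subset_leq_card/subsetP => a; rewrite inE => /orP [] /set1P ->.
  by apply: mem_face_nbrs; rewrite ?in_fac0 ?adj_fl0.
apply: mem_face_nbrs; first by rewrite in_fac0 in_fac1.
by rewrite -(vtx1 y) adj_fl0.
Qed.

Definition next2 y : {set M} := vtx (fl0 (fl1 (fl0 y))).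

Lemma root_nbrs3 y : y \in fac x -> next2 y <> vtx (fl0 (fl1 y)) ->
  3 <= #|face_nbrs x y|.
Proof.
move=> Fy n2; have /adj_irrefl ne := xchordal Fy.
have F0 : fl0 y \in fac x by rewrite in_fac0.
apply: (@card_ge3 _ _ (vtx (fl0 y)) (vtx (fl0 (fl1 y))) (next2 y)).
- by apply: mem_face_nbrs; rewrite ?in_fac0 ?adj_fl0.
- apply: mem_face_nbrs; first by rewrite in_fac0 in_fac1.
  by rewrite -(vtx1 y) adj_fl0.
- apply: mem_face_nbrs; first by rewrite in_fac0 in_fac1 in_fac0.
  by have := xchordal F0; rewrite /chordal fl0K.
- exact/eqP.
- by apply/eqP; rewrite -(vtx1 (fl0 y)); apply: noloop.
- by apply/eqP; apply: nesym.
Qed.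

(* The walk reads b a c b a around the corner [y], with c at [y]. *)
Definition repeated y := (next2 y == vtx (fl0 (fl1 y))) && (next2 (fl1 y) == vtx (fl0 y)).

Lemma repeated_fl1 y : repeated (fl1 y) = repeated y.
Proof. by rewrite /repeated fl1K andbC. Qed.

(** The two neighbours on the walk are distinct by chordality. Unless the corner is repeated, the
    vertex two steps away on one side is a third neighbour; at a repeated corner the hypothesis
    leaves a neighbouring corner out of [K]. *)
Lemma root_good K : face_transversal x K ->
  (forall z, z \in K -> repeated z -> fl0 z \in K -> fl0 (fl1 z) \in K -> False) ->
  forall z, z \in K -> good_corner x K z.
Proof.
case=> KF K1 _ _ nrep z Kz; have Fz := KF z Kz; rewrite /good_corner.
have [/eqP n2|/eqP n2] := boolP (next2 z == vtx (fl0 (fl1 z))); last first.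
  by left; apply: root_nbrs3.
have [/eqP n2'|/eqP n2'] := boolP (next2 (fl1 z) == vtx (fl0 z)); last first.
  left; have -> : face_nbrs x z = face_nbrs x (fl1 z) by rewrite /face_nbrs vtx1.
  by apply: root_nbrs3; rewrite ?in_fac1 ?fl1K.
right; split; first exact: root_nbrs2.
rewrite -negb_and; apply/negP => /andP [? ?]; apply: (nrep z) => //.
by rewrite /repeated n2 n2' !eqxx.
Qed.

Lemma root_face_size y : y \in fac x -> 3 < face_size y.
Proof.
move=> Fy; have m0 : 0 < face_size y by apply: order_gt0.
have per : iter (face_size y) s y = y by apply: iter_order; apply: face_step_inj.
case: (face_size y) m0 per => [|[|[|[|n]]]] // _ /= e.
- by case: (@noloop y); rewrite -{1}e vtx1.
- have /adj_irrefl := xchordal Fy; case; rewrite -[y in RHS]e.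
  by rewrite fl0_fl1_face_step vtx1.
- by move: ntx; rewrite -(tri_fac Fy) => /negP []; apply/eqP.
Qed.

(* Keeping first occurrences along the walk started one step before a corner
   that is not repeated leaves no repeated corner between kept neighbours. *)
Lemma first_occurrence_transversal y : y \in fac x -> ~~ repeated (s y) ->
  exists2 K, face_transversal x K &
    forall z, z \in K -> repeated z -> fl0 z \in K -> fl0 (fl1 z) \in K -> False.
Proof.
move=> Fy nrep; set m := face_size y; pose p i := iter i s y; pose v i := vtx (p i).
have m4 : 3 < m := root_face_size Fy.
have per : p m = y by apply: iter_order; apply: face_step_inj.
have perD i : p (i + m) = p i by rewrite /p iterD -/(p m) per.
have Fp i : p i \in fac x by apply: iter_face_fac.
pose first (i : 'I_m) := [forall j : 'I_m, (j < i) ==> (v j != v i)].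
have p_inj (i j : 'I_m) : p i = p j -> i = j.
  have u : uniq (traject s y m).
    by rewrite /m /face_size -/(orbit s y) orbit_uniq.
  move/eqP; rewrite /p -(nth_traject s (ltn_ord i)) -(nth_traject s (ltn_ord j)).
  by rewrite nth_uniq ?size_traject // => /eqP /val_inj.
pose K := [set z | [exists i : 'I_m, first i && ((z == p i) || (z == fl1 (p i)))]].
have KP z : reflect (exists2 i : 'I_m, first i & z = p i \/ z = fl1 (p i)) (z \in K).
  rewrite inE; apply: (iffP existsP) => [[i /andP [fi /orP e]]|[i fi e]].
    by exists i => //; case: e => /eqP; auto.
  by exists i; rewrite fi /=; case: e => ->; rewrite eqxx ?orbT.
have K1 z : (fl1 z \in K) = (z \in K).
  have H t : t \in K -> fl1 t \in K.
    by case/KP => i fi e; apply/KP; exists i => //; case: e => ->; rewrite ?fl1K; auto.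
  by apply/idP/idP => [/H|/H //]; rewrite fl1K.
have vE (i : 'I_m) z : z = p i \/ z = fl1 (p i) -> vtx z = v i.
  by case=> ->; rewrite ?vtx1.
have first_inj (i j : 'I_m) : first i -> first j -> v i = v j -> i = j.
  move=> /forallP /(_ j) fi /forallP /(_ i) fj e; apply: val_inj.
  by move: fi fj; rewrite e eqxx /= !implybF; lia.
have firstK n j : n < m -> p n \in K -> j < n -> v j <> v n.
  move=> nm /KP [i fi [e|e]] jn; last by case: (face_walk_oriented2 e).
  have ni : n = i by have /(congr1 val) := p_inj (Ordinal nm) i e.
  have jm := ltn_trans jn nm.
  by move/forallP: fi => /(_ (Ordinal jm)); rewrite -ni /= jn => /eqP.
exists K.
  split=> //.
  - by move=> z /KP [i _ [->|->]]; rewrite ?in_fac1.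
  - move=> z z' /KP [i fi zi] /KP [j fj zj]; rewrite (vE _ _ zi) (vE _ _ zj) => e.
    rewrite (first_inj _ _ fi fj e) in zi.
    by case: zi => ->; case: zj => ->; rewrite ?fl1K; auto.
  - move=> z Fz; have [i im /(vE (Ordinal im)) ->] := face_walk_cover Fy Fz.
    have [|j /eqP e jmin] := @arg_minnP _ (Ordinal im) (fun j : 'I_m => v j == v i) (@nat_of_ord m).
      by rewrite eqxx.
    exists (p j) => //; apply/KP; exists j; last by left.
    apply/forallP => k; apply/implyP => kj; apply: contraL kj => /eqP ke.
    by rewrite -leqNgt; apply: jmin; rewrite ke e.
suff H (i : 'I_m) : p i \in K -> repeated (p i) -> fl0 (p i) \in K ->
    fl0 (fl1 (p i)) \in K -> False.
  move=> z /[dup] Kz /KP [i _ [ez|ez]]; first by move: Kz; rewrite ez; apply: H.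
  by move: Kz; rewrite ez repeated_fl1 K1 fl1K => *; apply: (H i).
have pS j : s (p j) = p j.+1 by [].
move=> Ki /andP [/eqP r1 /eqP r2] K0i K1i.
have Kn : p i.+1 \in K by rewrite -pS /s /face_step K1.
have n2E j : next2 (p j) = v j.+2 by rewrite /next2 /v -!pS /s /face_step vtx1.
have prevE j : fl0 (fl1 (p j.+1)) = p j by rewrite -pS fl0_fl1_face_step.
have next2' j : next2 (fl1 (p j.+2)) = v j.
  by rewrite /next2 prevE -pS fl0_fl1_face_step.
have nextE j : vtx (fl0 (p j)) = v j.+1 by rewrite /v -pS vtx1.
have im := ltn_ord i; rewrite n2E in r1; rewrite nextE in r2.
case: (nat_of_ord i) im Ki r1 r2 K0i K1i Kn => [|[|i']] im Ki r1 r2 K0i K1i Kn.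
(* At position 0 the preceding corner, at [m - 1], has the vertex of position 2, so it is no first
   occurrence: [2 < m - 1]. *)
- have e0 : p 0 = p m.-1.+1 by rewrite prednK ?per //; lia.
  rewrite e0 prevE in r1 K1i.
  by apply: (@firstK m.-1 2) => //; lia.
- by move: (nrep : ~~ repeated (p 1)); rewrite /repeated n2E nextE r1 r2 !eqxx.
(* The following corner [i' + 3] has the vertex of position [i']. If the walk closes there,
   [i' + 3 = m], the preceding corner [i' + 1] has the vertex of position 1 instead. *)
- rewrite prevE in r1 K1i; rewrite next2' in r2.
  have [lt|ge] := ltnP i'.+3 m.
    by apply: (@firstK i'.+3 i') => //; lia.
  have mE : m = i'.+3 by lia.
  have e1 : v i'.+4 = v 1 by rewrite /v -(perD 1) mE.
  by apply: (@firstK i'.+1 1) => //; [lia|lia|rewrite -e1].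
Qed.

(* If every corner is repeated the walk is a b c a b c ..., and keeping every
   other of six consecutive corners works. *)
Lemma periodic_transversal : (forall y, y \in fac x -> repeated y) ->
  exists2 K, face_transversal x K &
    forall z, z \in K -> repeated z -> fl0 z \in K -> fl0 (fl1 z) \in K -> False.
Proof.
move=> rep; pose p i := iter i s x; pose v i := vtx (p i).
have Fx := fac_refl x.
have Fp i : p i \in fac x by apply: iter_face_fac.
have pS j : s (p j) = p j.+1 by [].
have prevE j : fl0 (fl1 (p j.+1)) = p j by rewrite -pS fl0_fl1_face_step.
have v3 j : v j.+3 = v j.
  have /andP [/eqP + _] := rep _ (Fp j.+1); rewrite prevE -/(v j) => <-.
  by rewrite /next2 /v -!pS /s /face_step vtx1.
have n1 j : v j <> v j.+1.
  by rewrite /v -pS /s /face_step vtx1; apply: noloop.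
have n2 j : v j <> v j.+2.
  have /adj_irrefl := xchordal (Fp j.+1); rewrite prevE => /nesym.
  by rewrite -(vtx1 (fl0 _)).
have np3 j : p j <> p j.+3.
  move=> e; move: ntx; rewrite -(tri_fac (Fp j)) /tri.
  by rewrite -[X in ~~ X]/(p j.+3 == p j) -e eqxx.
(* Since vertices recur with period three, positions 1, 3, 5 show each vertex once. Positions 2 and
   4 stay out, and every chosen corner is next to one of them. *)
pose sq := [:: p 1; fl1 (p 1); p 3; fl1 (p 3); p 5; fl1 (p 5)].
have parity i j : p i <> fl1 (p j) by apply: face_walk_oriented2.
have out2 : p 2 \notin sq.
  rewrite !inE; apply/negP => /or4P [| | |/or3P []] /eqP e //.
  - by apply: (n1 1); rewrite /v e.
  - by case: (parity _ _ e).
  - by apply: (n1 2); rewrite /v e.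
  - by case: (parity _ _ e).
  - by case: (np3 _ e).
  - by case: (parity _ _ e).
have out4 : p 4 \notin sq.
  rewrite !inE; apply/negP => /or4P [| | |/or3P []] /eqP e //.
  - by case: (np3 1).
  - by case: (parity _ _ e).
  - by apply: (n1 3); rewrite /v e.
  - by case: (parity _ _ e).
  - by apply: (n1 4); rewrite /v e.
  - by case: (parity _ _ e).
have sq1 z : (fl1 z \in sq) = (z \in sq).
  rewrite !inE !(can2_eq (@fl1K M) (@fl1K M)) !fl1K.
  by do !case: (_ == _).
have d13 : v 1 <> v 3 := n2 1.
have d15 : v 1 <> v 5 by rewrite (v3 2); apply: n1.
have d35 : v 3 <> v 5 := n2 3.
have d31 := nesym d13; have d51 := nesym d15; have d53 := nesym d35.
exists [set z in sq]; last first.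
  have o1 : (fl0 (p 1) \in sq) = false.
    by rewrite -[fl0 _]fl1K sq1; apply: negbTE.
  have o1' : (fl0 (fl1 (fl1 (p 1))) \in sq) = false by rewrite fl1K.
  have o3 : (fl0 (fl1 (p 3)) \in sq) = false by rewrite prevE; apply: negbTE.
  have o5 : (fl0 (fl1 (p 5)) \in sq) = false by rewrite prevE; apply: negbTE.
  move=> z; rewrite ![_ \in [set _ in _]]inE => zs _ a b.
  have := zs; rewrite /sq !in_cons orbF => /or4P [| | |/or3P []] /eqP ez; move: a b;
    by rewrite ez ?o1 ?o1' ?o3 ?o5.
split.
- move=> z; rewrite inE /sq !in_cons orbF => /or4P [| | |/or3P []] /eqP ->;
  by [exact: Fp|rewrite in_fac1; apply: Fp].
- by move=> z; rewrite ![_ \in [set _ in _]]inE sq1.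
- have sqP z : z \in sq -> exists2 c, c \in [:: 1; 3; 5] & z = p c \/ z = fl1 (p c).
    rewrite /sq !in_cons orbF => /or4P [| | |/or3P []] /eqP ->;
      [exists 1|exists 1|exists 3|exists 3|exists 5|exists 5] => //; by [left|right].
  have vinj c c' : c \in [:: 1; 3; 5] -> c' \in [:: 1; 3; 5] -> v c = v c' -> c = c'.
    by rewrite !inE => /or3P [] /eqP -> /or3P [] /eqP ->.
  have vE z c : z = p c \/ z = fl1 (p c) -> vtx z = v c by case=> ->; rewrite ?vtx1.
  move=> z z'; rewrite ![_ \in [set _ in _]]inE => /sqP [c cs zc] /sqP [c' cs' zc'].
  rewrite (vE _ _ zc) (vE _ _ zc') => /(vinj _ _ cs cs') ec; rewrite -ec in zc'.
  by case: zc => ->; case: zc' => ->; rewrite ?fl1K; auto.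
move=> z Fz.
have [i _ zi] := face_walk_cover Fx Fz.
have -> : vtx z = v i by case: zi => ->; rewrite ?vtx1.
have [j [j3 ->]] : exists j, j < 3 /\ v i = v j.
  elim/ltn_ind: i {zi} => -[|[|[|i]]] IH; [by exists 0|by exists 1|by exists 2|].
  by have [|j [j3 e]] := IH i; [lia|exists j; rewrite v3].
case: j j3 => [|[|[|j]]] // _.
- by exists (p 3); [rewrite !inE eqxx ?orbT|apply: v3].
- by exists (p 1); [rewrite !inE eqxx ?orbT|].
- by exists (p 5); [rewrite !inE eqxx ?orbT|apply: v3].
Qed.

Lemma root_transversal :
  exists2 K, face_transversal x K & forall z, z \in K -> good_corner x K z.
Proof.
have [/forall_inP rep|/forall_inPn /= [y Fy nrep]] :=
    boolP [forall (y | y \in fac x), repeated y].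
  by have [K tK /(root_good tK)] := periodic_transversal rep; exists K.
(* [fl0 (fl1 y)] is one face step before [y]. *)
have [||K tK /(root_good tK)] := @first_occurrence_transversal (fl0 (fl1 y)).
- by rewrite in_fac0 in_fac1.
- by rewrite /s /face_step fl0K fl1K.
- by exists K.
Qed.

End RootFace.

End Transversals.

(** * The filling process: its invariant and its termination *)

Definition filling (G M : flag_system) (phi : G -> M) (P : {set M}) : Prop :=
  [/\ is_map M, same_surface G M, submap phi, forall x : M, 3 <= pot x
    & (forall y, y \in P -> chordal y) /\ forall x, face_kind P x].

Lemma star_filling (G M : flag_system) (phi : G -> M) (P K : {set M}) (z : M) :
  filling phi P -> face_transversal z K -> z \in K -> ~~ tri z ->
  (forall y, y \in fac z -> vtx (fl0 y) <> vtx (fl0 (fl1 y))) ->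
  (forall y, y \in fac z -> y \notin K -> y \in P) ->
  (exists2 y, y \in K & y \in P) ->
  (forall y, y \in K -> good_corner z K y) ->
  exists (M' : flag_system) (phi' : G -> M') (P' : {set M'}),
    filling phi' P' /\ #|P'| < #|P|.
Proof.
move=> [mapM [eul ori] sub potM [Pch Pkind]] [KF K1 Kinj Ksurj] Kz ntz nb FP [y0 Ky0 Py0] good.
exists (star Kz KF K1), (old Kz KF K1 \o phi), (star_pristine Kz KF K1 P); split.
  split.
  - exact: star_is_map.
  - split; first by rewrite euler_char_star.
    by apply: (iff_trans ori); apply: orientable_star.
  - exact: submap_star.
  - have ps k : 3 <= pot (spoke Kz KF K1 k).
      by apply: pot_spoke => //; apply: good; apply: valP.
    move=> u; case: (star_flagP u) => -[x ->]; first exact: pot_old.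
      exact: ps.
    by rewrite -fl0_spoke pot_fl0.
  - split; last exact: face_kind_star.
    move=> u /imsetP [x + ->]; rewrite inE => /andP [nKx /Pch cx].
    by rewrite /chordal fl1_old // !fl0_old; apply: adj_old.
rewrite card_imset; last exact: old_inj.
apply: proper_card; apply/properP; split; first exact: subsetDl.
by exists y0; rewrite // inE Ky0.
Qed.

(** An untouched face is starred along [root_transversal], a hatted one along [hat_transversal]. *)
Lemma filling_step (G M : flag_system) (phi : G -> M) (P : {set M}) (x : M) :
  filling phi P -> ~~ tri x ->
  exists (M' : flag_system) (phi' : G -> M') (P' : {set M'}),
    filling phi' P' /\ #|P'| < #|P|.
Proof.
move=> fil ntx; have [mapM _ _ _ [Pch Pkind]] := fil.
case: (Pkind x) => [t|xP|[z xz hz]]; first by rewrite t in ntx.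
  have xch y : y \in fac x -> chordal y by move/xP/Pch.
  have [K [KF K1 Kinj Ksurj] good] := root_transversal mapM ntx xch.
  have [z Kz _] := Ksurj x (fac_refl x).
  have e := facP _ _ (KF z Kz); have Fx := fac_refl x.
  have goodz y : y \in K -> good_corner z K y.
    by move/good; rewrite /good_corner /face_nbrs e.
  rewrite e in KF Ksurj xP xch Fx.
  apply: (star_filling fil (z := z) (K := K)) => //.
  - by rewrite -(tri_fac Fx).
  - by move=> y /xch /(adj_irrefl mapM).
  - by move=> y /xP.
  - by exists z => //; apply/xP/fac_refl.
have ntz : ~~ tri z by rewrite (tri_fac xz).
have [K [tK Kz FP KP]] := hat_transversal mapM Pch hz ntz.
apply: (star_filling fil tK) => //.
- exact: hat_noback Pch hz ntz.
- by move=> y Ky; left; apply: (hat_face_nbrs mapM Pch hz ntz); case: tK => + _ _ _; apply.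
Qed.

Lemma filling_complete (G M : flag_system) (phi : G -> M) (P : {set M}) :
  filling phi P ->
  exists (T : flag_system) (psi : G -> T) (Q : {set T}),
    filling psi Q /\ forall x : T, tri x.
Proof.
have [n] := ubnP #|P|; elim: n => // n IH in M phi P * => ltP fil.
have [/forallP t|/forallPn [x ntx]] := boolP [forall x : M, tri x].
  by exists M, phi, P.
have [M' [phi' [P' [fil' lt]]]] := filling_step fil ntx.
by apply: IH fil'; apply: leq_trans lt ltP.
Qed.

(** * Potentials in the given map *)

Section Initial.

Variable G : flag_system.
Hypothesis mapG : is_map G.
Implicit Types (x y z : G) (a b c : {set G}).

(** A 3-cycle through an edge is determined by its third vertex, a common neighbour of the two
    ends. *)
Lemma three_cyclesE x :
  three_cycles_through x = [set [set vtx x; vtx (fl0 x); c] | c in common x].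
Proof.
have ne := @noloop _ mapG x.
apply/setP => C; rewrite inE; apply/idP/imsetP.
  case/and3P => /existsP [p /existsP [q /existsP [r /and4P [pq qr rp /eqP ->]]]].
  have [qp rq pr] : [/\ adj q p, adj r q & adj p r] by split; rewrite adj_sym.
  rewrite !inE => /orP [/orP []|] /eqP ea /orP [/orP []|] /eqP eb;
    try (by case: ne; rewrite ea eb);
    [exists r|exists q|exists r|exists p|exists q|exists p];
    try (by rewrite inE ea eb; apply/andP);
    by apply/setP => d; rewrite !inE ea eb; do 3!case: (d == _).
case=> c; rewrite inE => /andP [xc cx] ->; apply/and3P; split; last 2 first.
- by rewrite !inE eqxx.
- by rewrite !inE eqxx orbT.
apply/existsP; exists (vtx x); apply/existsP; exists (vtx (fl0 x)).
by apply/existsP; exists c; rewrite adj_fl0 adj_sym cx adj_sym xc eqxx.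
Qed.

Lemma card_three_cycles x : #|three_cycles_through x| = #|common x|.
Proof.
rewrite three_cyclesE card_in_imset // => c d.
rewrite !inE => /andP [/(adj_irrefl mapG) xc /(adj_irrefl mapG) c0] _ /setP /(_ c).
rewrite !inE eqxx orbT => /esym /orP [/orP []|] /eqP // e; first by case: xc.
Qed.

Lemma pot_fl2 x : pot (fl2 x) = pot x.
Proof.
rewrite /pot fl2K addnAC; congr (_ + _ + _); apply: eq_card => c.
by rewrite !inE fl02C !vtx2.
Qed.

Definition prev x : {set G} := vtx (fl0 (fl1 x)).

Lemma tri_prev x : tri x -> prev (fl0 x) = prev x.
Proof. by rewrite triE /prev => /eqP <-; rewrite vtx1. Qed.

Lemma tri_common x : tri x -> prev x \in common x.
Proof.
move=> tx; rewrite inE -[in X in X && _](vtx1 x) adj_fl0 /=.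
by rewrite -(tri_prev tx) adj_sym -(vtx1 (fl0 x)) adj_fl0.
Qed.

(* Two edges at [vtx x] towards the same neighbour coincide, so [vtx x] has
   degree two. *)
Lemma prev_eq_comm x : prev x = prev (fl2 x) -> fl1 (fl2 x) = fl2 (fl1 x).
Proof.
case: mapG => _ _ _ simple /esym e.
have : fl1 (fl2 x) \in edg (fl1 x).
  by apply/edgP; apply: simple; rewrite ?vtx1 ?vtx2.
have nl := @noloop _ mapG (fl1 x).
case/edg_inP => // e'.
- by have /eqP[] := fl2_neq x; apply: (can_inj (@fl1K G)).
- by case: nl; rewrite -e' !vtx1 vtx2.
- by case: nl; rewrite -[in RHS]vtx2 -fl02C -e' !vtx1 vtx2.
Qed.

Lemma vtx_degree2 x y : fl1 (fl2 x) = fl2 (fl1 x) -> y \in vtx x ->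
  [\/ y = x, y = fl1 x, y = fl2 x | y = fl2 (fl1 x)].
Proof.
move=> e; move: y; apply: orbit2_ind; first by constructor 1.
- move=> y _ [] ->; rewrite ?fl1K -?e ?fl1K ?e;
    by [constructor 2|constructor 1|constructor 4|constructor 3].
- move=> y _ [] ->; rewrite ?fl2K;
    by [constructor 3|constructor 4|constructor 1|constructor 2].
Qed.

Hypothesis Gch : forall x, ~~ tri x -> chordal x.

(** By chordality [prev x] and [prev (fl0 x)] are common neighbours, and so is the apex
    [prev (fl2 x)] if the other side is a triangle. Two different ones, or a second large side,
    suffice; the case where all three coincide is contradictory. *)
Lemma pot_large x : ~~ tri x -> 3 <= pot x.
Proof.
move=> ntx; rewrite /pot ntx.
have nt0 : ~~ tri (fl0 x) by rewrite tri_fl0.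
have c1 : prev x \in common x.
  rewrite inE -[in X in X && _](vtx1 x) adj_fl0 /= adj_sym; exact: Gch.
have c2 : prev (fl0 x) \in common x.
  rewrite inE adj_sym; have := Gch nt0; rewrite /chordal fl0K adj_sym => -> /=.
  by rewrite adj_sym -(vtx1 (fl0 x)) adj_fl0.
have two (a b : {set G}) : a \in common x -> b \in common x -> a != b -> 1 < #|common x|.
  move=> ca cb ab; have -> : 2 = #|[set a; b]| by rewrite cards2 ab.
  by apply/subset_leq_card/subsetP => c; rewrite in_set2 => /orP [] /eqP ->.
have [e|ne] := eqVneq (prev x) (prev (fl0 x)); last first.
  by have := two _ _ c1 c2 ne; lia.
have [t2|nt2] := boolP (tri (fl2 x)); last first.
  by have : 0 < #|common x| by [apply/card_gt0P; exists (prev x)]; lia.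
have c3 : prev (fl2 x) \in common x.
  by have := tri_common t2; rewrite !inE fl02C !vtx2.
have [e2|ne] := eqVneq (prev x) (prev (fl2 x)); last first.
  by have := two _ _ c1 c3 ne; lia.
(* Now both ends of the edge have degree two. *)
have d1 := prev_eq_comm e2.
have d0 : fl1 (fl2 (fl0 x)) = fl2 (fl1 (fl0 x)).
  by apply: prev_eq_comm; rewrite -fl02C (tri_prev t2) -e2 e.
(* Chordality at [z] makes [prev z] a neighbour of [vtx x]. As [vtx x] has degree two, [prev z] must
   be [vtx (fl0 x)]; each of the four flags at that vertex is then ruled out. *)
pose z := fl0 (fl1 x).
have ntz : ~~ tri z by rewrite tri_fl0 tri_fl1.
have tB : tri (fl0 (fl1 z)) = false.
  by rewrite tri_fl0 tri_fl1; apply: negbTE.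
have : adj (vtx x) (prev z).
  by have := Gch ntz; rewrite /chordal /z fl0K vtx1.
case/adjP => t /esym /vtxP /(vtx_degree2 d1) tE te.
have nz : prev x <> prev z.
  by rewrite /prev -/z -(vtx1 z); apply: noloop.
have : fl0 (fl1 z) \in vtx (fl0 x).
  apply/vtxP; rewrite -/(prev z) -te.
  by case: tE te => -> te; rewrite ?fl02C ?vtx2 //; case: nz;
    rewrite -te ?fl02C ?vtx2.
case/(vtx_degree2 d0) => e3.
- have /eqP[] := fl0_neq (fl1 x); apply: (can_inj (@fl1K G)).
  by rewrite fl1K; apply: (can_inj (@fl0K G)).
- move: ntx; rewrite triE; case/negP; apply/eqP; apply: (can_inj (@fl0K G)).
  by rewrite fl0K.
- by move: tB; rewrite e3 tri_fl02 t2.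
- by move: tB; rewrite e3 -d0 tri_fl1 tri_fl02 t2.
Qed.

(** An edge between two triangles with different apexes and at most two common neighbours lies on
    just the two 3-cycles bounding these triangles, hence is contractible. *)
Lemma pot_initial : (forall x, ~ contractible x) ->
  (forall x, 3 <= pot x) \/ exists x, [/\ tri x, tri (fl2 x) & prev x = prev (fl2 x)].
Proof.
move=> nc.
have [/existsP [x /and3P [t1 t2 /eqP e]]|/existsPn none] :=
    boolP [exists x, [&& tri x, tri (fl2 x) & prev x == prev (fl2 x)]].
  by right; exists x.
left=> x; have [t1|/pot_large //] := boolP (tri x).
have [t2|/pot_large] := boolP (tri (fl2 x)); last by rewrite pot_fl2.
have := none x; rewrite t1 t2 /= => ne.
rewrite /pot t1 t2 !addn0 leqNgt; apply/negP => lt3; case: (nc x).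
have c1 := tri_common t1.
have c2 : prev (fl2 x) \in common x.
  by have := tri_common t2; rewrite !inE fl02C !vtx2.
have sub : [set prev x; prev (fl2 x)] \subset common x.
  by apply/subsetP => c; rewrite in_set2 => /orP [] /eqP ->.
have card2 : #|[set prev x; prev (fl2 x)]| = 2 by rewrite cards2 ne.
have comE : common x = [set prev x; prev (fl2 x)].
  by apply/esym/eqP; rewrite eqEcard sub card2.
split; first by rewrite card_three_cycles comE.
have bound y : tri y -> bounds_three_face [set vtx y; vtx (fl0 y); prev y].
  move=> ty; apply/existsP; exists y; apply/andP; split.
    by apply/eqP/(face_size3 _ mapG).
  rewrite /face_vertex /= /face_step !vtx1; apply/eqP.
  by rewrite -(tri_prev ty).
move=> C; rewrite three_cyclesE comE => /imsetP [c + ->].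
rewrite !inE => /orP [] /eqP ->; first exact: bound.
by have := bound _ t2; rewrite fl02C !vtx2.
Qed.

End Initial.

Lemma submap_id (G : flag_system) : submap (@id G).
Proof.
split=> //; last by move=> y; exists y.
by move=> y; exists 0.
Qed.

(** * The 3-cycle on the sphere, completed to the tetrahedron *)

Section ThreeCycle.

Variables (G : flag_system) (x : G).
Hypotheses (mapG : is_map G) (t1 : tri x) (t2 : tri (fl2 x)).
Hypothesis prev2 : prev x = prev (fl2 x).
Implicit Types (y z : G).

Definition face6 y : seq G :=
  [:: y; fl1 y; fl0 y; fl1 (fl0 y); fl0 (fl1 y); fl0 (fl1 (fl0 y))].

Lemma tri_fac6 y z : tri y -> z \in fac y -> z \in face6 y.
Proof.
rewrite triE => /eqP ty; move: z; apply: orbit2_ind; first by rewrite inE eqxx.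
- move=> z _; rewrite !inE => /or4P [| | |/or3P []] /eqP ->;
  by rewrite ?fl0K eqxx ?orbT.
- move=> z _; rewrite !inE => /or4P [| | |/or3P []] /eqP ->;
  by rewrite ?fl1K ?ty -?ty ?fl1K eqxx ?orbT.
Qed.

Let d1 : fl1 (fl2 x) = fl2 (fl1 x). Proof. exact: prev_eq_comm. Qed.

Let d0 : fl1 (fl2 (fl0 x)) = fl2 (fl1 (fl0 x)).
Proof.
by apply: prev_eq_comm; rewrite // -fl02C (tri_prev t2) (tri_prev t1).
Qed.

Let a := vtx x.
Let b := vtx (fl0 x).
Let c := prev x.

Let ab : a <> b. Proof. exact: noloop. Qed.
Let ac : a <> c. Proof. by rewrite /a -(vtx1 x); apply: noloop. Qed.
Let bc : b <> c.
Proof. by rewrite /c -(tri_prev t1) /b -(vtx1 (fl0 x)); apply: noloop. Qed.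

(** [fl2] exchanges the two triangles, so by connectedness there is no further face. *)
Let faceE y : y \in fac x \/ y \in fac (fl2 x).
Proof.
have F2 z : z \in fac x -> fl2 z \in fac (fl2 x).
  move/(tri_fac6 t1); rewrite /face6 !in_cons orbF => /or4P [| | |/or3P []] /eqP ->;
  by rewrite -?fl02C -?d0 -?d1 -?fl02C ?(in_fac0, in_fac1) fac_refl.
have F2' z : z \in fac (fl2 x) -> fl2 z \in fac x.
  move/(tri_fac6 t2); rewrite /face6 !in_cons orbF => /or4P [| | |/or3P []] /eqP ->;
  by rewrite ?fl02C -?fl02C ?d1 ?fl02C ?d0 ?fl02C ?fl2K ?(in_fac0, in_fac1) fac_refl.
case: mapG => _ conn _ _; have /connectP [p xp ->] := conn x y.
elim/last_ind: p xp => [|p z IH]; first by left; apply: fac_refl.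
rewrite rcons_path last_rcons => /andP [/IH + e].
by case/or3P: e => /eqP ->; case=> H; rewrite ?in_fac0 ?in_fac1; auto.
Qed.

Let verticesE : vertices G = [set a; b; c].
Proof.
have va y : vtx y \in [set a; b; c].
  have c0 := tri_prev t1; have c2 := tri_prev t2.
  rewrite !inE; case: (faceE y) => [/(tri_fac6 t1)|/(tri_fac6 t2)];
    rewrite !inE => /or4P [| | |/or3P []] /eqP ->;
    rewrite ?vtx1 -/(prev _) ?c2 ?c0 -?prev2 ?fl02C ?vtx2 ?eqxx ?orbT //.
apply/setP => v; apply/imsetP/idP => [[y _ ->] //|].
rewrite !inE => /orP [/orP []|] /eqP ->; [exists x|exists (fl0 x)|exists (fl0 (fl1 x))] => //.
Qed.

Lemma card_vertices_three_cycle : #|vertices G| = 3.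
Proof.
rewrite verticesE setUC cardsU1 cards2 !inE !(eq_sym c) negb_or.
by move/eqP: ab => ->; move/eqP: ac => ->; move/eqP: bc => ->.
Qed.

Let card_edges : #|edges G| = 3.
Proof.
(* In a simple graph, edges may be counted by their pairs of ends. *)
pose ends y := [set vtx y; vtx (fl0 y)].
rewrite (@eq_card_imset _ _ _ _ ends); last first.
  move=> y z _ _; split=> [/edgP yz|].
    apply/esym; apply: orbit2_inv yz => t; rewrite /ends.
      by rewrite fl0K setUC.
    by rewrite fl02C !vtx2.
  case: mapG => _ _ _ simple; rewrite /ends => /setP e.
  have nz := @noloop _ mapG z; have ny := @noloop _ mapG y.
  have /esym := e (vtx y); have /esym := e (vtx (fl0 y)); rewrite !inE !eqxx orbT /=.
  case/orP => /eqP e0 /orP [] /eqP e1.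
  - by case: ny; rewrite e0 e1.
  - rewrite -[edg z]edg0; apply: simple; rewrite ?fl0K //.
  - exact: simple.
  - by case: ny; rewrite e0 e1.
have -> : ends @: G = [set [set a; b]; [set a; c]; [set b; c]].
  have inV y : vtx y \in [set a; b; c] by rewrite -verticesE imset_f.
  apply/setP => v; apply/imsetP/idP => [[y _ ->]|].
    have := inV y; have := inV (fl0 y); rewrite !inE /ends; have := @noloop _ mapG y.
    move=> ny; case/orP => [/orP []|] /eqP e0; case/orP => [/orP []|] /eqP e1;
      try (by case: ny; rewrite e0 e1); rewrite e0 e1;
      by [rewrite eqxx ?orbT|rewrite setUC eqxx ?orbT].
  have c0 := tri_prev t1.
  rewrite !inE => /orP [/orP []|] /eqP ->.
  - by exists x.
  - by exists (fl1 x); rewrite // /ends vtx1.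
  - by exists (fl1 (fl0 x)); rewrite // /ends vtx1 -/(prev _) c0.
have E (s t : {set {set G}}) u : u \in s -> u \notin t -> s != t.
  by move=> su; apply: contraNneq => <-.
have [nab nac nbc] : [/\ a != b, a != c & b != c] by split; apply/eqP.
have e1 : [set a; b] != [set a; c].
  by apply: (E _ _ b); rewrite !inE ?eqxx ?orbT // negb_or eq_sym nab.
have e2 : [set b; c] != [set a; b].
  by apply: (E _ _ c); rewrite !inE ?eqxx ?orbT // negb_or !(eq_sym c) nac nbc.
have e3 : [set b; c] != [set a; c].
  by apply: (E _ _ b); rewrite !inE ?eqxx ?orbT // negb_or eq_sym nab.
by rewrite setUC cardsU1 cards2 !inE !negb_or e1 e2 e3.
Qed.

Let card_faces : #|faces G| = 2.
Proof.
have -> : faces G = [set fac x; fac (fl2 x)].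
  apply/setP => v; apply/imsetP/idP => [[y _ ->]|].
    by rewrite !inE; case: (faceE y) => /facP ->; rewrite eqxx ?orbT.
  by rewrite !inE => /orP [] /eqP ->; [exists x|exists (fl2 x)].
rewrite cards2; suff -> : fac x != fac (fl2 x) by [].
apply/eqP => /facP /(tri_fac6 t1).
have c0 := tri_prev t1.
rewrite !inE => /or4P [| | |/or3P []] /eqP e.
- by have := fl2_neq x; rewrite e eqxx.
- by apply: bc; rewrite /c /prev -e fl02C vtx2.
- by apply: ab; rewrite /b -e vtx2.
- by apply: ab; rewrite /b -[in RHS]vtx1 -e vtx2.
- by apply: ac; rewrite /c /prev -e vtx2.
- by apply: ac; rewrite /c -c0 /prev -e vtx2.
Qed.

(** Here [K] is the whole face: in a triangle each vertex has exactly one corner. *)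
Lemma tetrahedron_star :
  exists (T : flag_system) (phi : G -> T), [/\ tetrahedron T, same_surface G T & submap phi].
Proof.
have Kz : x \in fac x := fac_refl x.
have KF : {subset fac x <= fac x} by [].
have K1 y : (fl1 y \in fac x) = (y \in fac x) by rewrite in_fac1.
have Kinj y z : y \in fac x -> z \in fac x -> vtx y = vtx z -> z = y \/ z = fl1 y.
  have [[ba ca] cb] : (b <> a /\ c <> a) /\ c <> b by split; [split|]; apply: nesym.
  have c0 : vtx (fl0 (fl1 (fl0 x))) = c := tri_prev t1.
  have cE : vtx (fl0 (fl1 x)) = c by [].
  have c1 : fl1 (fl0 (fl1 x)) = fl0 (fl1 (fl0 x)) by apply/eqP; rewrite -triE.
  have c1' : fl1 (fl0 (fl1 (fl0 x))) = fl0 (fl1 x) by rewrite -c1 fl1K.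
  move=> /(tri_fac6 t1) + /(tri_fac6 t1); rewrite !inE.
  by do 2![case/or4P => [| | |/or3P []] /eqP ->];
    rewrite ?vtx1 ?c0 ?cE -/a -/b ?c1 ?c1' ?fl1K; auto.
pose T := star Kz KF K1.
have mapT : is_map T by apply: star_is_map.
have euT : euler_char T = 2%R.
  rewrite euler_char_star /euler_char card_vertices_three_cycle card_edges card_faces.
  by [].
have vT : #|vertices T| = 4 by rewrite card_vertices_star card_vertices_three_cycle.
have tG y : tri y by case: (faceE y) => /tri_fac ->.
have tT (u : T) : tri u.
  have told y : tri (old Kz KF K1 y).
    have [Fy|nFy] := boolP (y \in fac x); last by rewrite tri_old_out.
    by apply: tri_old; rewrite ?in_fac0.
  case: (star_flagP u) => -[y ->] //.
    by rewrite -tri_fl1 fl1_spoke.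
  by rewrite -tri_fl0 fl0_hub -tri_fl1 fl1_spoke.
exists T, (old Kz KF K1 \o id); split.
- split=> //; split=> //; first by move=> u; apply/(face_size3 _ mapT).
  case=> /existsP [p /existsP [q /existsP [r /and4P [_ _ _ /eqP e]]]] _.
  have : #|vertices T| <= 3.
    rewrite e setUC cardsU1 cards2.
    by case: (_ \notin _); case: (_ != _).
  by rewrite vT.
- by split; [rewrite euler_char_star|apply: orientable_star].
- exact/submap_star/submap_id.
Qed.

End ThreeCycle.

(** * From the submap to the removed vertices *)

Lemma submap_obtained (G T : flag_system) (phi : G -> T) : submap phi ->
  exists2 W : {set {set T}}, W \subset vertices T & obtained_by_removing W G.
Proof.
case=> inj comm skip clos.
(* The removed vertices are those missed by [phi]. *)
pose W := [set a in vertices T | [forall x, vtx (phi x) != a]].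
have WP y : vtx y \notin W -> exists x, vtx (phi x) = vtx y.
  rewrite inE imset_f //= => /forallPn [x /negbNE /eqP e]; by exists x.
have nW x : vtx (phi x) \notin W.
  by rewrite inE negb_and; apply/orP; right; apply/forallPn; exists x; rewrite eqxx.
have keptP y : kept W y <-> exists x, phi x = y.
  split=> [/andP [/WP y0 /WP y1]|[x <-]]; first exact: clos.
  by rewrite /kept -(comm x).1 !nW.
exists W; first by apply/subsetP => a; rewrite inE => /andP [].
exists phi; split=> //.
- move=> x; have [n [e nim]] := skip x; exists n; split=> // k kn.
  by apply/negP => /keptP [y]; apply: nim.
- by move=> _ /imsetP [y _ ->] /WP.
Qed.

Theorem theorem4 (G : flag_system) (hG : irreducible_map G) :
  exists (T : flag_system) (W : {set {set T}}),
    [/\ irreducible_triangulation T,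
        same_surface G T,
        W \subset vertices T
      & obtained_by_removing W G].
Proof.
case: hG => mapG firr nc.
have Gch (x : G) : ~~ tri x -> chordal x.
  (* The walk starts one step before [x], so its positions 0 and 2 are the neighbours of the corner
     [x]. *)
  move=> ntx; case: (firr (fl0 (fl1 x))) => [[_ /(_ 0)]|/(face_size3 _ mapG)].
    by rewrite /face_vertex /= /face_step fl0K fl1K vtx1 adj_sym.
  by rewrite tri_fl0 tri_fl1 (negbTE ntx).
have [potG|[x [t1 t2 e]]] := pot_initial mapG Gch nc; last first.
  have [T [phi [tetT ssT /submap_obtained [W WV rem]]]] := tetrahedron_star mapG t1 t2 e.
  by exists T, W; split=> //; split; [case: tetT|left].
have fil : filling (@id G) [set x : G | ~~ tri x].
  split=> //.
  - exact: submap_id.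
  - split=> [y|x]; first by rewrite inE => /Gch.
    have [tx|ntx] := boolP (tri x); [by constructor 1|constructor 2] => y xy.
    by rewrite inE (tri_fac xy).
have [T [phi [Q [[mapT ssT subT potT _] tT]]]] := filling_complete fil.
have [W WV rem] := submap_obtained subT.
have cn (x : T) : 3 <= #|common x| by have := potT x; rewrite /pot !tT !addn0.
exists T, W; split=> //; split; last first.
  by right=> x [card2 _]; have := cn x; rewrite -(card_three_cycles mapT) card2.
split=> //; first by move=> x; apply/(face_size3 _ mapT).
(* A vertex with an edge leaving it, together with three common neighbours of the ends, already
   makes four vertices. *)
case=> /existsP [p /existsP [q /existsP [r /and4P [_ _ _ /eqP e]]]] _.
have [x _] : exists x : T, True by case: mapT.
have /subset_leq_card : common x \subset vertices T :\ vtx x.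
  apply/subsetP => c; rewrite !inE => /andP [xc _].
  rewrite (adj_vertex xc) andbT; apply/eqP => ec.
  by case: (adj_irrefl mapT xc).
have : #|vertices T| <= 3.
  rewrite e setUC cardsU1 cards2.
  by case: (_ \notin _); case: (_ != _).
rewrite (cardsD1 (vtx x)) imset_f // add1n => lt3 le3.
by have := leq_trans (cn x) (leq_trans le3 lt3); rewrite ltnn.
Qed.
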